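(* Let $T>0$, $a_1,a_2\in\mathbb R$, and $$\lambda(t)=a_1(T-t)^{-\frac27},\qquad \mu(t)=a_2(T-t)^{-\frac37}.$$ Then there is no nontrivial ($B\not\equiv0$) solution $B$ of $$B_t+\nabla\times((\nabla\times B)\times B)=0,\qquad \nabla\cdot B=0\quad\text{in }\mathbb R^3$$ of the pseudo-self-similar form $$B(x,t)=\mu(t)\,H(\lambda(t)x)$$ for a profile vector field $H:\mathbb R^3\to\mathbb R^3$, which is regular on $[0,T)$, satisfies $$\operatorname*{ess\,sup}_{0<t<T}\|B(t)\|_{L^2(\mathbb R^3)}<\infty,$$ and such that additionally at least one of the following two conditions holds: $$\operatorname*{ess\,sup}_{0<t<T}\|B(t)\|_{L^p(\mathbb R^3)}<\infty\quad\text{for some }p>2,$$ or $$\lim_{t\to T^-}\int_0^t\|\nabla\times J(\cdot,\tau)\|_{L^\infty}\,d\tau<\infty,\qquad J=\nabla\times B.$$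
   Context: The system is the electron MHD system with zero resistivity; $J=\nabla\times B$ is the current density. ''Regular on $[0,T)$'' means that $B$ is a (sufficiently smooth) classical solution on $\mathbb R^3\times[0,T)$. *)

(* Defs.v *)
From HB Require Import structures.
From mathcomp Require Import all_boot all_order all_algebra.
From mathcomp Require Import all_classical all_reals all_analysis.
From mathcomp Require Import ess_sup_inf.
Import Order.TTheory GRing.Theory Num.Theory.
Import numFieldNormedType.Exports.

Set Implicit Arguments.
Unset Strict Implicit.
Unset Printing Implicit Defensive.

Local Open Scope classical_set_scope.
Local Open Scope ring_scope.

Section VectorCalculus.
Context {R : realType}.
Notation V := 'rV[R]_3.

Definition partial (i : 'I_3) (F : V -> V) : V -> V :=
  fun x => 'D_(delta_mx 0 i) F x.

(* In [cross] and [curl] the coordinate indices are added modulo 3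
   (the ring structure of 'I_3), which gives the usual cyclic formulas. *)
Definition cross (u v : V) : V :=
  \row_i (u 0 (i + 1) * v 0 (i + 2) - u 0 (i + 2) * v 0 (i + 1)).

Definition curl (F : V -> V) : V -> V :=
  fun x => \row_i (partial (i + 1) F x 0 (i + 2) - partial (i + 2) F x 0 (i + 1)).

Definition div3 (F : V -> V) : V -> R :=
  fun x => \sum_i partial i F x 0 i.

(* The norm `|u| of 'rV[R]_3 is the maximum norm, hence this definition. *)
Definition eucl (u : V) : R := Num.sqrt (\sum_i u 0 i ^+ 2).

End VectorCalculus.

Section Lebesgue.
Context {R : realType}.
Notation V := 'rV[R]_3.

(* 'rV[R]_3 carries no measurable structure: the Lebesgue measure of R^3 is
   the product measure on R * R * R, and [point3] identifies the two spaces. *)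
Definition leb3 : {measure set (measurableTypeR R * measurableTypeR R *
                                measurableTypeR R) -> \bar R} :=
  ((lebesgue_measure \x lebesgue_measure) \x lebesgue_measure)%E.

Definition point3 (q : R * R * R) : V :=
  \row_i tnth [tuple q.1.1; q.1.2; q.2] i.

(* ||F||_(L^p(R^3)), with value in [0, +oo]; p = +oo is allowed *)
Definition normLp (p : \bar R) (F : V -> V) : \bar R :=
  Lnorm leb3 p (fun q => (eucl (F (point3 q)))%:E).

Definition ess_sup_time (T : R) (f : R -> \bar R) : \bar R :=
  ess_sup (mrestr lebesgue_measure (measurable_itv `]0%R, T[)) f.

End Lebesgue.

Section ElectronMHD.
Context {R : realType}.
Notation V := 'rV[R]_3.

Definition continuous_on (A : set R) (F : R -> V -> V) : Prop :=
  {within [set z : R * V | A z.1], continuous (fun z => F z.1 z.2)}.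

(* B is of class C^2 in x with all these derivatives jointly continuous on
   R^3 x [0, T), initial time included, and of class C^1 in t for 0 < t < T. *)
Definition regular (T : R) (B : R -> V -> V) : Prop :=
  [/\ forall (i : 'I_3) (t : R) (x : V), 0 <= t < T -> derivable (B t) x (delta_mx 0 i),
      forall (i j : 'I_3) (t : R) (x : V), 0 <= t < T ->
        derivable (partial i (B t)) x (delta_mx 0 j),
      [/\ continuous_on `[0, T[ B,
          forall i, continuous_on `[0, T[ (fun t => partial i (B t))
        & forall i j,
          continuous_on `[0, T[ (fun t => partial j (partial i (B t)))],
      forall (t : R) (x : V), 0 < t < T -> derivable (fun s => B s x) t 1
    & continuous_on `]0, T[ (fun t x => derive1 (fun s => B s x) t)].

Definition electron_MHD (T : R) (B : R -> V -> V) : Prop :=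
  (forall (t : R) (x : V), 0 < t < T ->
     derive1 (fun s => B s x) t
       + curl (fun y => cross (curl (B t) y) (B t y)) x = 0) /\
  (forall (t : R) (x : V), 0 <= t < T -> div3 (B t) x = 0).

(* The values of B t for t outside [0, T) are irrelevant. *)
Definition classical_solution (T : R) (B : R -> V -> V) : Prop :=
  regular T B /\ electron_MHD T B.

End ElectronMHD.

(* Main.v *)
Require Import Defs.
From HB Require Import structures.
From mathcomp Require Import all_boot all_order all_algebra.
From mathcomp Require Import all_classical all_reals all_analysis.
From mathcomp Require Import ess_sup_inf ring lra.
Import Order.TTheory GRing.Theory Num.Theory.
Import numFieldNormedType.Exports.
Local Open Scope classical_set_scope.
Local Open Scope ring_scope.

(** The exponents are such that the L^2 norm of B(t) does not depend on t,
    whereas, with s proportional to T - t, its L^p norm scales like a negative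
    power of s for p > 2, and the sup norm of curl J scales like 1/s.  The first
    alternative thus fails unless B = 0, and the second one unless curl J = 0.
    In that case G = B(t_0) is an L^2 field with div G = 0, curl (curl G) = 0.
    Integrating div (psi G x J), J = curl G, against cutoffs psi at scale r gives
    int psi |J|^2 <= C/r^2, so J = 0.  Then the stress tensor
    T_ij = G_i G_j - |G|^2 delta_ij / 2 is divergence free, and testing it with
    the bounded field psi x/rho, rho = sqrt(1 + |x|^2), for which
    T : D(x/rho) = - (|G|^2/2 + (x.G)^2)/rho^3, gives
    int psi |G|^2/rho^3 <= C/r, so G = 0. *)

(** [H] is seen only through the values of [B], and for [a1 = 0] only at the origin, so no
    regularity of [H] is available. A slice of [B] replaces it as profile: in the ratio of two
    slices the constants [a1], [a2] cancel, whatever their signs. The time t_0 has to be picked with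
    care, as the essential supremum gives a finite L^2 norm at almost every time only. Nothing is
    known beforehand about the integrability of J. This is why psi is a square phi^2: the term with
    grad psi = 2 phi grad phi is absorbed by half of psi |J|^2, and what remains is |grad phi|^2
    |G|^2. For the stress tensor, the dilation field x already gives T : Dx = - |G|^2/2, but its
    flux, of size |x| |grad psi| |G|^2, carries no decay in r. Division by rho bounds the field, so
    that the flux is O(1/r), and it keeps the sign of the bulk term. Cubes replace balls: on a cube
    a partial derivative integrates to zero by Fubini and the one-variable fundamental theorem, and
    a polynomial that vanishes on the faces can serve as phi. *)

Section Boxes.
Context {R : realType}.
Notation V := 'rV[R]_3.
Notation mR := (measurableTypeR R).
Notation R3 := (mR * mR * mR)%type.

Lemma normr_rV3_le (v : V) (r : R) : 0 <= r ->
  (`|v| <= r) = [forall i, `|v 0 i| <= r].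
Proof.
move=> r0; apply/idP/forallP => [vr i|vr].
  apply: le_trans vr; rewrite /Num.norm/= mx_normrE.
  exact: (le_bigmax _ (fun ij : 'I_1 * 'I_3 => `|v ij.1 ij.2|) (0, i)).
rewrite /Num.norm/= mx_normrE; apply: bigmax_le => // -[i j] _ /=.
by rewrite (ord1 i).
Qed.

(** Balls of the maximum norm are cubes. They are pulled back along [point3] to the product space,
    which carries the measure. *)
Definition box3 (a : V) (r : R) : set R3 := [set q | `|point3 q - a| <= r].

Lemma forall_ord3 (P : 'I_3 -> bool) :
  [forall i, P i] = [&& P 0, P 1 & P 2%:R].
Proof.
apply/forallP/and3P => [h|[h0 h1 h2] i]; first by split; exact: h.
have : i \in [:: 0; 1; 2%:R] by case: i => -[|[|[|]]].
by rewrite !inE => /or3P[] /eqP ->.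
Qed.

Lemma box3E (a : V) (r : R) : 0 <= r -> box3 a r =
  (`[a 0 0 - r, a 0 0 + r] `*` `[a 0 1 - r, a 0 1 + r]) `*`
    `[a 0 2%:R - r, a 0 2%:R + r].
Proof.
move=> r0; apply/seteqP; split => [q|q]; rewrite /box3 /=.
  rewrite normr_rV3_le// forall_ord3 => /and3P[]; rewrite !mxE => h0 h1 h2.
  by split; [split|]; rewrite /= in_itv/= -ler_distlC distrC.
rewrite !in_itv/= -!ler_distlC => -[[h0 h1] h2].
rewrite normr_rV3_le// forall_ord3; apply/and3P; rewrite !mxE.
by split; rewrite distrC.
Qed.

Lemma measurable_box3 (a : V) (r : R) : 0 <= r -> measurable (box3 a r).
Proof.
move=> r0; rewrite box3E//.
by apply: measurableX; [apply: measurableX|]; exact: measurable_itv.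
Qed.

Lemma lebesgue_measure_box3 (a : V) (r : R) : 0 <= r ->
  leb3 (box3 a r) = ((2 * r) ^+ 3)%:E.
Proof.
move=> r0; rewrite box3E//.
have mI (b c : R) : measurable (`[b, c]%classic : set mR) by exact: measurable_itv.
pose l : {measure set mR -> \bar R} := lebesgue_measure.
rewrite [LHS](@product_measure1E _ _ _ _ R (l \x lebesgue_measure)%E
  lebesgue_measure)//; last by apply: measurableX; exact: mI.
rewrite [X in (X * _)%E](@product_measure1E _ _ _ _ R l lebesgue_measure)//.
have H (b : R) : lebesgue_measure (`[b - r, b + r]%classic : set mR) = (2 * r)%:E.
  rewrite lebesgue_measure_itv/= lte_fin.
  case: ltP => [_|h]; first by rewrite -EFinB; congr EFin; ring.
  have -> : r = 0 by lra.
  by rewrite mulr0.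
transitivity ((2 * r)%:E * (2 * r)%:E * (2 * r)%:E)%E.
  by congr (_ * _ * _)%E; exact: H.
by rewrite -!EFinM; congr EFin; ring.
Qed.

(** Cubes with rational centre and radius 1/(n+1) are countably many, so the preimage of an open set
    is measurable; hence continuous functions are measurable through [point3]. *)
Lemma open_box3_cover (A : set V) : open A ->
  (fun q : R3 => point3 q) @^-1` A =
  \bigcup_(c in [set c : nat * (rat * rat * rat) |
      box3 (point3 (ratr c.2.1.1, ratr c.2.1.2, ratr c.2.2)) c.1.+1%:R^-1
        `<=` (fun q : R3 => point3 q) @^-1` A])
    box3 (point3 (ratr c.2.1.1, ratr c.2.1.2, ratr c.2.2)) c.1.+1%:R^-1.
Proof.
move=> oA; apply/seteqP; split => [q /= Aq|q [c /= ]]; last exact.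
have /nbhs_ballP[e /= e0 eA] := open_nbhs_nbhs (conj oA Aq).
(* The radius is below e/2 because two points of one cube are compared through its centre. *)
have [n _ hn] := near_infty_natSinv_lt (PosNum (divr_gt0 e0 (ltr0Sn R 1))).
have n0 : 0 < n.+1%:R^-1 :> R by rewrite invr_gt0 ltr0n.
have ratP (x : R) : exists c : rat, `|x - ratr c| <= n.+1%:R^-1.
  have [|c] := @rat_in_itvoo R (x - n.+1%:R^-1) (x + n.+1%:R^-1).
    by rewrite -subr_gt0; set y := _^-1 in n0 *; lra.
  by rewrite in_itv/= => h; exists c; rewrite ltW// ltr_distlC.
have [c0 h0] := ratP q.1.1; have [c1 h1] := ratP q.1.2; have [c2 h2] := ratP q.2.
have qc : `|point3 q - point3 (ratr c0, ratr c1, ratr c2)| <= n.+1%:R^-1.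
  by rewrite normr_rV3_le ?(ltW n0)// forall_ord3; apply/and3P; rewrite !mxE.
exists (n, (c0, c1, c2)) => //= q'; rewrite /box3 /= => q'c.
apply: eA; rewrite -ball_normE /ball_/=.
rewrite (le_lt_trans (ler_distD (point3 (ratr c0, ratr c1, ratr c2)) _ _))//.
rewrite [X in _ + X]distrC.
have /= := hn n (leqnn n); move: qc q'c; rewrite /=.
by move: (_%:R^-1) `|_| `|_| => *; lra.
Qed.

Lemma measurable_point3 (f : V -> R) : continuous f ->
  measurable_fun setT (fun q : R3 => f (point3 q)).
Proof.
move=> /continuousP cf; apply: (measurability _ (measurable_realfun.RGenOpens.measurableE R)).
move=> _ [_ [a [b ->] <-]]; rewrite setTI.
have oA := cf _ (@interval_open R _ _ _ _).
rewrite (_ : _ @^-1` _ = (fun q : R3 => point3 q) @^-1` (f @^-1` `]a, b[))//.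
rewrite open_box3_cover; last exact: oA.
rewrite bigcup_mkcond; apply: countable_bigcupT_measurable => // c.
by case: ifPn => // _; apply: measurable_box3.
Qed.
End Boxes.

(** * Vanishing of integrals by Fubini *)

Section FubiniVanish.
Context d1 d2 (T1 : measurableType d1) (T2 : measurableType d2) {R : realType}.
Variables (m1 : {sigma_finite_measure set T1 -> \bar R}).
Variables (m2 : {sigma_finite_measure set T2 -> \bar R}).
Variable f : T1 * T2 -> \bar R.
Hypothesis intf : (m1 \x m2)%E.-integrable setT f.
Local Open Scope ereal_scope.

Lemma integral_prod_eq0_snd :
  (forall x, \int[m2]_y f (x, y) = 0) -> \int[(m1 \x m2)%E]_q f q = 0.
Proof.
move=> f0; rewrite -integral12_prod_meas1// /fubini_F.
by under eq_integral do rewrite f0; rewrite integral0.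
Qed.

(** The slice may be assumed integrable, which holds for almost every y. This allows iteration: when
    the slice lives on a product itself, Fubini applies to it again. *)
Lemma integral_prod_eq0_fst :
  {ae m2, forall y, m1.-integrable setT (fun x => f (x, y)) ->
    \int[m1]_x f (x, y) = 0} -> \int[(m1 \x m2)%E]_q f q = 0.
Proof.
move=> f0; rewrite -integral21_prod_meas1//.
rewrite -[RHS](integral0 m2 setT); apply: ae_eq_integral => //.
  exact: (measurable_fubini_G intf).
by move: f0 (ae_integrable2 intf); apply: filterS2 => y h1 h2 _; exact: h1.
Qed.
End FubiniVanish.

Section SquareMeasure.
Context {R : realType}.
Notation mR := (measurableTypeR R).
Local Open Scope ereal_scope.

(* The library's sigma-finite instance on \x is not inferred (a subprobability
   instance has the same key), so it is rebuilt for the square. *)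
Definition leb2 : set (mR * mR) -> \bar R :=
  (@lebesgue_measure R \x @lebesgue_measure R)%E.

HB.instance Definition _ := Measure.on leb2.

Lemma leb2_sigma_finite : sigma_finite setT leb2.
Proof.
have mI (b c : R) : measurable (`[b, c]%classic : set mR).
  exact: measurable_itv.
pose I n : set mR := `[(- n%:R)%R, n%:R]%classic.
exists (fun n => I n `*` I n).
  apply/seteqP; split => // -[x y] _.
  pose n := maxn (Num.truncn `|x|%R).+1 (Num.truncn `|y|%R).+1.
  have nP (z : R) : ((Num.truncn `|z|%R).+1 <= n)%N -> I n z.
    move=> zn; rewrite /I/= in_itv/= -ler_norml.
    by rewrite (le_trans (ltW (truncnS_gt _)))// ler_nat.
  by exists n => //; split; apply: nP; rewrite leq_max leqnn ?orbT.
move=> n; split; first by apply: measurableX; exact: mI.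
rewrite /leb2 [X in X < _](@product_measure1E _ _ _ _ R
  (lebesgue_measure : {measure set mR -> \bar R}) lebesgue_measure);
  [|exact: mI..].
rewrite lte_mul_pinfty// ?ge0_fin_numE//= lebesgue_measure_itv/=;
  by case: ifPn => // _; rewrite -EFinB ltry.
Qed.

HB.instance Definition _ := Measure_isSigmaFinite.Build _ _ _ leb2
  leb2_sigma_finite.
End SquareMeasure.

(** * Integration by parts on cubes *)

Section BoxIntegral.
Context {R : realType}.
Notation V := 'rV[R]_3.
Notation mR := (measurableTypeR R).
Notation R3 := (mR * mR * mR)%type.
Notation e i := (delta_mx 0 i : 'rV[R]_3).

Lemma is_derive_line {W : V -> R} {v u : V} {s dW : R} :
  is_derive (s *: u + v) u W dW -> is_derive s 1 (fun s => W (s *: u + v)) dW.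
Proof.
have E : (fun h : R => h^-1 *: (((fun s => W (s *: u + v)) \o shift s) (h *: (1:R))
    - W (s *: u + v))) =
  (fun h : R => h^-1 *: ((W \o shift (s *: u + v)) (h *: u) - W (s *: u + v))).
  apply/funext => h /=; congr (_ *: (W _ - _)).
  by rewrite [h *: _]mulr1 scalerDl addrA.
by case=> dv dE; split; [rewrite /derivable E|rewrite /derive E].
Qed.

(** As v has no component along [e i], the line misses the cube or meets it exactly for -r <= s <=
    r. Its two end points lie on faces where W vanishes, so the fundamental theorem gives zero. *)
Lemma integral_line_eq0 (i : 'I_3) (W dW : V -> R) (r : R) (v : V) :
  0 < r -> v 0 i = 0 ->
  (forall x, is_derive x (e i) W (dW x)) -> continuous dW ->
  (forall x : V, `|x 0 i| = r -> W x = 0) ->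
  (\int[lebesgue_measure]_s
     ((EFin \o dW) \_ [set x | (`|x| <= r)%R]) (s *: e i + v)%R = 0)%E.
Proof.
move=> r0 vi dWP cdW W0.
have nP s : (`|s *: e i + v| <= r) = (s \in `[(-r), r]) && (`|v| <= r).
  rewrite !normr_rV3_le ?ltW// in_itv/= -ler_norml.
  apply/forallP/andP => [h|[h1 /forallP h2] j].
    split; first by have := h i; rewrite !mxE !eqxx mulr1 vi addr0.
    apply/forallP => j; have := h j; rewrite !mxE eqxx.
    by case: (j =P i) => [->|_]; rewrite ?vi ?normr0 ?(ltW r0)// mulr0 add0r.
  have := h2 j; rewrite !mxE eqxx.
  by case: (j =P i) => [->|_]; rewrite ?vi ?addr0 ?mulr1// mulr0 add0r.
have memE s : (s *: e i + v \in [set x : V | `|x| <= r]) =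
    (s \in `[(-r), r]) && (`|v| <= r).
  by rewrite -nP; apply/idP/idP; rewrite inE.
have lineP s := is_derive_line (dWP (s *: e i + v)).
have [vr|vr] := leP `|v| r; last first.
  rewrite -[RHS](integral0 lebesgue_measure setT); apply: eq_integral => s _.
  by rewrite patchE memE leNgt vr andbF.
transitivity (\int[lebesgue_measure]_(s in `[(-r)%R, r]) (dW (s *: e i + v)%R)%:E)%E.
  rewrite [RHS]integral_mkcond; apply: eq_integral => s _; rewrite !patchE.
  by rewrite memE vr andbT mem_setE.
have cline : continuous (fun s : R => s *: e i + v).
  move=> s; apply: cvgD; last exact: cvg_cst.
  by apply: cvgZr_tmp; exact: cvg_id.
have cW : continuous (fun s : R => W (s *: e i + v)).
  move=> s; apply: differentiable_continuous.
  by apply/derivable1_diffP; case: (lineP s).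
rewrite (@continuous_FTC2 R (fun s : R => dW (s *: e i + v))
  (fun s : R => W (s *: e i + v)))//; last 4 first.
- by rewrite gtrN.
- apply: continuous_subspaceT => s.
  by apply: continuous_comp; [exact: cline|exact: cdW].
- split => [s _||]; first by case: (lineP s).
  + by apply: cvg_at_right_filter; exact: cW.
  + by apply: cvg_at_left_filter; exact: cW.
- by move=> s _ /=; rewrite derive1E; case: (lineP s).
rewrite !W0 ?subee// !mxE !eqxx mulr1 vi addr0 ?normrN gtr0_norm//.
Qed.
End BoxIntegral.

Section IntegralOverBoxes.
Context {R : realType}.
Notation V := 'rV[R]_3.
Notation mR := (measurableTypeR R).
Notation R3 := (mR * mR * mR)%type.
Notation e i := (delta_mx 0 i : 'rV[R]_3).

Lemma continuous_bounded_ball (f : V -> R) (r : R) : 0 <= r -> continuous f ->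
  exists M, forall x : V, `|x| <= r -> `|f x| <= M.
Proof.
move=> r0 cf; pose K := [set x : V | `|x| <= r].
have cK : compact K.
  apply: bounded_closed_compact.
    exists r; split; first exact: num_real.
    by move=> M rM x /le_trans; apply; exact: ltW.
  rewrite (_ : K = (fun x : V => `|x|) @^-1` [set t | t <= r])//.
  by apply: preimage_closed => [x _|]; [exact: norm_continuous|exact: closed_le].
have [|||c _ h] := @EVT_max_rV R 3 (fun x => `|f x|) K.
- by exists 0; rewrite /K/= normr0.
- exact: cK.
- apply: continuous_subspaceT => x; apply: continuous_comp; first exact: cf.
  exact: norm_continuous.
by exists `|f c| => x xr; apply: h; rewrite inE.
Qed.

Lemma integrable_box (f : V -> R) (r : R) : 0 <= r -> continuous f ->
  leb3.-integrable (box3 0 r) (EFin \o (fun q => f (point3 q))).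
Proof.
move=> r0 cf; apply: measurable_bounded_integrable.
- exact: measurable_box3.
- by rewrite lebesgue_measure_box3// ltry.
- by apply: measurable_funTS; exact: measurable_point3.
have [M hM] := continuous_bounded_ball f r r0 cf.
exists M; split; first exact: num_real.
move=> N MN q /=; rewrite /box3/= subr0 => /hM /le_trans; apply; exact: ltW.
Qed.

Lemma point3_line0 (x y z : R) :
  point3 (x, y, z) = x *: e 0 + point3 (0, y, z).
Proof.
apply/rowP => i; rewrite !mxE /= eq_sym.
have : i \in [:: 0; 1; 2%:R] by case: i => -[|[|[|]]].
by rewrite !inE => /or3P[] /eqP -> /=; rewrite ?mulr1 ?mulr0 ?addr0 ?add0r.
Qed.

Lemma point3_line1 (x y z : R) :
  point3 (x, y, z) = y *: e 1 + point3 (x, 0, z).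
Proof.
apply/rowP => i; rewrite !mxE /= eq_sym.
have : i \in [:: 0; 1; 2%:R] by case: i => -[|[|[|]]].
by rewrite !inE => /or3P[] /eqP -> /=; rewrite ?mulr1 ?mulr0 ?addr0 ?add0r.
Qed.

Lemma point3_line2 (x y z : R) :
  point3 (x, y, z) = z *: e 2%:R + point3 (x, y, 0).
Proof.
apply/rowP => i; rewrite !mxE /= eq_sym.
have : i \in [:: 0; 1; 2%:R] by case: i => -[|[|[|]]].
by rewrite !inE => /or3P[] /eqP -> /=; rewrite ?mulr1 ?mulr0 ?addr0 ?add0r.
Qed.

Definition intbox (r : R) (f : V -> R) : R :=
  \int[leb3]_(q in box3 0 r) f (point3 q).

Lemma intbox_derive (i : 'I_3) (W dW : V -> R) (r : R) : 0 < r ->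
  (forall x, is_derive x (e i) W (dW x)) -> continuous dW ->
  (forall x : V, `|x 0 i| = r -> W x = 0) ->
  intbox r dW = 0.
Proof.
move=> r0 dWP cdW W0; rewrite /intbox /Rintegral integral_mkcond.
(* The integrand is extended by zero as a function on [V], so that it can be restricted to arbitrary
   lines. *)
pose g (x : V) := ((EFin \o dW) \_ [set x | `|x| <= r]) x.
have gE : (fun q : R3 => (dW (point3 q))%:E) \_ (box3 0 r) =
    (fun q : R3 => g (point3 q)).
  apply/funext => q; rewrite /g !patchE /box3; congr (if _ then _ else _).
  by apply/idP/idP; rewrite !inE/= subr0.
have ig : leb3.-integrable setT (fun q : R3 => g (point3 q)).
  rewrite -gE; apply/(integrable_mkcond _ (measurable_box3 0 r (ltW r0))).
  by apply: integrable_box => //; exact: ltW.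
pose l : {sigma_finite_measure set mR -> \bar R} := lebesgue_measure.
rewrite gE.
have line v j := integral_line_eq0 j W dW r v r0.
(* The integral in direction i must be the innermost one. The product being bracketed as (x, y), z,
   the three directions differ in the order of Fubini at each of its two levels. *)
have : i \in [:: 0; 1; 2%:R] by case: i {dWP W0} => -[|[|[|]]].
rewrite !inE => /or3P[] /eqP i_.
- rewrite [X in fine X](_ : _ = 0%E)//.
  apply: (@integral_prod_eq0_fst _ _ _ _ R leb2 l) => //.
  apply: aeW => z iz.
  apply: (@integral_prod_eq0_fst _ _ _ _ R l l) => //.
  apply: aeW => y iy.
  under eq_integral do rewrite point3_line0.
  by apply: line; rewrite ?mxE// -i_.
- rewrite [X in fine X](_ : _ = 0%E)//.
  apply: (@integral_prod_eq0_fst _ _ _ _ R leb2 l) => //.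
  apply: aeW => z iz.
  apply: (@integral_prod_eq0_snd _ _ _ _ R l l) => // x.
  under eq_integral do rewrite point3_line1.
  by apply: line; rewrite ?mxE// -i_.
- rewrite [X in fine X](_ : _ = 0%E)//.
  apply: (@integral_prod_eq0_snd _ _ _ _ R leb2 l) => // -[x y].
  under eq_integral do rewrite point3_line2.
  by apply: line; rewrite ?mxE// -i_.
Qed.

Section Linear.
Variables (r : R) (f g : V -> R).
Hypotheses (r0 : 0 <= r) (cf : continuous f) (cg : continuous g).

Lemma intboxD : intbox r (fun x => f x + g x) = intbox r f + intbox r g.
Proof.
by apply: RintegralD; [exact: measurable_box3|exact: integrable_box..].
Qed.

Lemma intboxB : intbox r (fun x => f x - g x) = intbox r f - intbox r g.
Proof.
by apply: RintegralB; [exact: measurable_box3|exact: integrable_box..].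
Qed.

Lemma intboxZ c : intbox r (fun x => c * f x) = c * intbox r f.
Proof. by apply: RintegralZl; [exact: measurable_box3|exact: integrable_box]. Qed.

Lemma le_intbox : (forall x : V, `|x| <= r -> f x <= g x) ->
  intbox r f <= intbox r g.
Proof.
move=> fg; apply: le_Rintegral; [exact: measurable_box3|exact: integrable_box..|].
by move=> q; rewrite /box3/= subr0; exact: fg.
Qed.
End Linear.

End IntegralOverBoxes.

(** The integral of a nonnegative function is a supremum over the simple functions below it, hence
    monotone even without measurability. This covers integrands such as tau |-> ||curl J(tau)||,
    whose measurability in time is not established. *)
Lemma ge0_le_integral_nonmeasurable d (T : measurableType d) (R : realType)
    (mu : {measure set T -> \bar R}) (D : set T) (f g : T -> \bar R) :
  (forall x, D x -> 0 <= f x)%E -> (forall x, D x -> f x <= g x)%E ->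
  (\int[mu]_(x in D) f x <= \int[mu]_(x in D) g x)%E.
Proof.
move=> f0 fg; have g0 x : D x -> (0 <= g x)%E.
  by move=> Dx; exact: le_trans (f0 x Dx) (fg x Dx).
rewrite (ge0_integralE _ f0) (ge0_integralE _ g0).
apply: ge_ereal_sup => _ [h /= hf <-]; apply: ereal_sup_ubound.
exists h => //= x.
apply: le_trans (hf x) _; rewrite !patchE.
by case: ifPn => // /set_mem; exact: fg.
Qed.

Lemma integral_ge_box (R : realType) (f : _ -> \bar R) (a : 'rV[R]_3) (r c : R) :
  0 <= r -> 0 <= c -> (forall q, 0 <= f q)%E ->
  (forall q, box3 a r q -> c%:E <= f q)%E ->
  ((c * (2 * r) ^+ 3)%:E <= \int[leb3]_q f q)%E.
Proof.
move=> r0 c0 f0 cf.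
rewrite EFinM -(lebesgue_measure_box3 a r r0) -(integral_cst leb3 (measurable_box3 a r r0)).
rewrite integral_mkcond; apply: ge0_le_integral_nonmeasurable => [q _|q _].
  by rewrite patchE; case: ifPn.
by rewrite patchE; case: ifPn => // /set_mem; exact: cf.
Qed.

(** * Calculus of C^1 scalar functions, divergence theorem and cutoffs *)

Section C1calculus.
Context {R : realType}.
Notation V := 'rV[R]_3.
Notation e i := (delta_mx 0 i : 'rV[R]_3).
Implicit Types f g : V -> R.
Implicit Types df dg : 'I_3 -> V -> R.

(* In a family [dg : 'I_3 -> 'I_3 -> V -> R] of derivatives of [g : 'I_3 -> V -> R],
   [dg j i] stands for the derivative of [g j] in direction [i]. *)
Definition C1 f df :=
  [/\ forall i x, is_derive x (e i) f (df i x), continuous f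
    & forall i, continuous (df i)].

Lemma C1_cst (c : R) : C1 (fun=> c) (fun _ _ => 0).
Proof. by split=> [i x||i]; [exact: is_derive_cst|exact: cst_continuous..]. Qed.

Lemma C1D {f df g dg} : C1 f df -> C1 g dg ->
  C1 (fun x => f x + g x) (fun i x => df i x + dg i x).
Proof.
move=> [hf cf cdf] [hg cg cdg]; split=> [i x|x|i x].
- exact: is_deriveD.
- exact: continuousD (cf x) (cg x).
- exact: continuousD (cdf i x) (cdg i x).
Qed.

Lemma C1B {f df g dg} : C1 f df -> C1 g dg ->
  C1 (fun x => f x - g x) (fun i x => df i x - dg i x).
Proof.
move=> [hf cf cdf] [hg cg cdg]; split=> [i x|x|i x].
- exact: is_deriveB.
- exact: continuousB (cf x) (cg x).
- exact: continuousB (cdf i x) (cdg i x).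
Qed.

Lemma C1M {f df g dg} : C1 f df -> C1 g dg ->
  C1 (fun x => f x * g x) (fun i x => df i x * g x + f x * dg i x).
Proof.
move=> [hf cf cdf] [hg cg cdg]; split=> [i x|x|i x].
- apply: (is_derive_eq (is_deriveM (hf i x) (hg i x))).
  by rewrite addrC /GRing.scale/= mulrC.
- exact: continuousM (cf x) (cg x).
- exact: continuousD (continuousM (cdf i x) (cg x))
                     (continuousM (cf x) (cdg i x)).
Qed.

Lemma C1_coord (j : 'I_3) : C1 (fun x => x 0 j) (fun i _ => (i == j)%:R).
Proof.
split=> [i x|x|i x]; [|exact: coord_continuous|exact: cst_continuous].
have E : (fun h : R => h^-1 *: (((fun x : V => x 0 j) \o shift x) (h *: e i) - x 0 j))
    @ 0^' --> ((i == j)%:R : R).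
  apply: cvg_near_cst; near=> h.
  rewrite /= !mxE eqxx addrK [j == i]eq_sym /GRing.scale/= mulKf//.
  by near: h; exact: nbhs_dnbhs_neq.
by split; [apply/cvg_ex; exists (i == j)%:R|exact/cvg_lim].
Unshelve. all: by end_near. Qed.

Lemma C1_eq {f df g dg} : C1 f df -> f =1 g -> (forall i, df i =1 dg i) -> C1 g dg.
Proof.
move=> h /funext <- hd; suff <- : df = dg by [].
by apply/funext => i; apply/funext; exact: hd.
Qed.

Lemma is_derive_line0 (W : V -> R) (x u : V) (d : R) :
  is_derive (0 : R) (1:R) (fun s : R => W (s *: u + x)) d -> is_derive x u W d.
Proof.
have E : (fun h : R => h^-1 *: (((fun s => W (s *: u + x)) \o shift 0) (h *: (1:R))
    - W (0 *: u + x))) =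
  (fun h : R => h^-1 *: ((W \o shift x) (h *: u) - W x)).
  by apply/funext => h /=; rewrite addr0 scale0r add0r [h *: _]mulr1.
by case=> dv dE; split; [move: dv; rewrite /derivable E|move: dE; rewrite /derive E].
Qed.

(** Along a line the composition is a function of one real variable, so the one-variable chain rule
    is enough. *)
Lemma C1_comp {f df} (h h' : R -> R) : C1 f df ->
  (forall x, is_derive (f x) 1 h (h' (f x))) -> continuous (h' \o f) ->
  C1 (h \o f) (fun i x => h' (f x) * df i x).
Proof.
move=> [hf cf cdf] hh ch; split=> [i x|x|i x].
- apply: is_derive_line0.
  have hx : is_derive (f (0 *: e i + x)) 1 h (h' (f x)).
    by rewrite scale0r add0r.
  apply: (is_derive1_comp hx); apply: is_derive_line.
  by rewrite scale0r add0r.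
- apply: continuous_comp; first exact: cf.
  by apply/differentiable_continuous/derivable1_diffP; case: (hh x).
- exact: continuousM (ch x) (cdf i x).
Qed.

Lemma sum3 (F : 'I_3 -> R) : \sum_i F i = F 0 + F 1 + F 2%:R.
Proof.
rewrite !big_ord_recl big_ord0 addr0 addrA.
by congr (F _ + F _ + F _); exact: val_inj.
Qed.

Lemma continuous_div {W : 'I_3 -> V -> R} {dW : 'I_3 -> 'I_3 -> V -> R} :
  (forall j, C1 (W j) (dW j)) ->
  continuous (fun x => dW 0 0 x + dW 1 1 x + dW 2%:R 2%:R x).
Proof.
move=> CW; have c j : continuous (dW j j) by case: (CW j).
by move=> x; exact: continuousD (continuousD (c _ x) (c _ x)) (c _ x).
Qed.

Lemma intbox_div {W : 'I_3 -> V -> R} {dW : 'I_3 -> 'I_3 -> V -> R} {r : R} : 0 < r ->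
  (forall j, C1 (W j) (dW j)) ->
  (forall j (x : V), `|x 0 j| = r -> W j x = 0) ->
  intbox r (fun x => dW 0 0 x + dW 1 1 x + dW 2%:R 2%:R x) = 0.
Proof.
move=> r0 CW W0; have c j : continuous (dW j j) by case: (CW j).
have r0' := ltW r0.
have z j : intbox r (dW j j) = 0.
  apply: (intbox_derive j (W j)) => //; last exact: W0.
  by move=> x; case: (CW j).
rewrite intboxD//; last by move=> x; exact: continuousD (c _ x) (c _ x).
by rewrite intboxD// !z !addr0.
Qed.

(** The function phi: a polynomial that vanishes on the faces of the cube of radius r and takes
    values in [0, 1] inside. It is integrated over that cube only. *)
Definition cutoff (r : R) (x : V) : R :=
  (1 - r^-1 ^+ 2 * (x 0 0 * x 0 0)) * (1 - r^-1 ^+ 2 * (x 0 1 * x 0 1)) *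
  (1 - r^-1 ^+ 2 * (x 0 2%:R * x 0 2%:R)).

Definition dcutoff (r : R) (i : 'I_3) (x : V) : R :=
  - 2 * r^-1 ^+ 2 * x 0 i * (1 - r^-1 ^+ 2 * (x 0 (i + 1) * x 0 (i + 1))) *
  (1 - r^-1 ^+ 2 * (x 0 (i + 2) * x 0 (i + 2))).

Lemma ord3E : ((0 + 1 = 1 :> 'I_3) * (0 + 2 = 2 :> 'I_3)) *
  ((1 + 1 = 2 :> 'I_3) * (1 + 2 = 0 :> 'I_3)) *
  ((2 + 1 = 0 :> 'I_3) * (2 + 2 = 1 :> 'I_3)).
Proof. by do !split; exact: val_inj. Qed.

Lemma ord3P (P : 'I_3 -> Prop) : P 0 -> P 1 -> P 2 -> forall i, P i.
Proof.
move=> P0 P1 P2 i; have : i \in [:: 0; 1; 2%:R] by case: i => -[|[|[|]]].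
by rewrite !inE => /or3P[] /eqP ->.
Qed.

Lemma C1_cutoff (r : R) : C1 (cutoff r) (dcutoff r).
Proof.
have Cq j := C1B (C1_cst 1) (C1M (C1_cst (r^-1 ^+ 2)) (C1M (C1_coord j) (C1_coord j))).
apply: (C1_eq (C1M (C1M (Cq 0) (Cq 1)) (Cq 2%:R))) => // i x.
by move: i; apply: ord3P; rewrite /dcutoff !ord3E /=; ring.
Qed.

Lemma cutoff_boundary (r : R) (j : 'I_3) (x : V) : 0 < r -> `|x 0 j| = r ->
  cutoff r x = 0.
Proof.
move=> r0 xr; have : r^-1 ^+ 2 * (x 0 j * x 0 j) = 1.
  have -> : x 0 j * x 0 j = r ^+ 2 by rewrite -xr real_normK ?num_real// expr2.
  by rewrite -exprMn mulVf ?gt_eqF// expr1n.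
rewrite /cutoff; move: j {xr}; apply: ord3P => ->;
  by rewrite subrr ?mul0r ?mulr0 ?mul0r.
Qed.
End C1calculus.

(** * Bounds on the cutoff and its gradient *)

Section CutoffBounds.
Context {R : realType}.
Notation V := 'rV[R]_3.

Lemma coord_le_norm (x : V) (j : 'I_3) : `|x 0 j| <= `|x|.
Proof.
have := lexx `|x|; rewrite normr_rV3_le// => /forallP; exact.
Qed.

Lemma scaled_sqr_coord_le (r s : R) (x : V) (j : 'I_3) : 0 < r -> 0 <= s ->
  `|x| <= s * r -> 0 <= r^-1 ^+ 2 * (x 0 j * x 0 j) <= s ^+ 2.
Proof.
move=> r0 s0 xr; have xj := le_trans (coord_le_norm x j) xr.
rewrite -expr2 -[x 0 j ^+ 2]real_normK ?num_real// -exprMn mulrC.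
rewrite exprn_ge0/= ?mulr_ge0 ?invr_ge0 ?(ltW r0)//.
by rewrite lerXn2r ?nnegrE ?mulr_ge0 ?invr_ge0 ?(ltW r0)// ler_pdivrMr.
Qed.

Lemma cutoff_itv (r : R) (x : V) : 0 < r -> `|x| <= r -> 0 <= cutoff r x <= 1.
Proof.
move=> r0 xr.
have h j : 0 <= 1 - r^-1 ^+ 2 * (x 0 j * x 0 j) <= 1.
  have := @scaled_sqr_coord_le r 1 x j r0 ler01; rewrite mul1r => /(_ xr).
  by move: (_ * _) => t; rewrite expr1n; lra.
rewrite /cutoff; move: (h 0) (h 1) (h 2%:R) => /andP[a0 a1] /andP[b0 b1] /andP[c0 c1].
by rewrite !mulr_ge0//= !mulr_ile1// mulr_ge0.
Qed.

Lemma cutoff_half (r : R) (x : V) : 0 < r -> `|x| <= 2^-1 * r ->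
  (3 / 4) ^+ 3 <= cutoff r x.
Proof.
move=> r0 xr.
have h j : 3 / 4 <= 1 - r^-1 ^+ 2 * (x 0 j * x 0 j).
  have := @scaled_sqr_coord_le r 2^-1 x j r0 ltac:(lra) xr.
  by move: (_ * _) => t; lra.
by rewrite exprS expr2 mulrA /cutoff !ler_pM//; lra.
Qed.

Lemma sqr_dcutoff_le (r : R) (i : 'I_3) (x : V) : 0 < r -> `|x| <= r ->
  dcutoff r i x ^+ 2 <= 4 * r^-1 ^+ 2.
Proof.
move=> r0 xr.
pose t j := r^-1 ^+ 2 * (x 0 j * x 0 j).
have h j : 0 <= t j <= 1.
  have := @scaled_sqr_coord_le r 1 x j r0 ler01; rewrite mul1r => /(_ xr).
  by rewrite expr1n.
(* One factor r^-2 is used to turn x_i^2 into t_i; beyond 4/r^2, only numbers in [0, 1] remain. *)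
have -> : dcutoff r i x ^+ 2 = 4 * r^-1 ^+ 2 *
    (t i * ((1 - t (i + 1)) * (1 - t (i + 2))) ^+ 2).
  by rewrite /dcutoff /t; ring.
rewrite ler_piMr//; first by rewrite mulr_ge0// exprn_ge0// invr_ge0 ltW.
have /andP[a0 a1] := h i; have /andP[b0 b1] := h (i + 1).
have /andP[c0 c1] := h (i + 2).
have p0 : 0 <= (1 - t (i + 1)) * (1 - t (i + 2)) by apply: mulr_ge0; lra.
have p1 : (1 - t (i + 1)) * (1 - t (i + 2)) <= 1 by apply: mulr_ile1; lra.
by rewrite mulr_ile1// ?exprn_ge0 ?exprn_ile1.
Qed.

Lemma intbox_ge_box (f : V -> R) (a : V) (r s c : R) :
  0 <= r -> 0 <= s -> 0 <= c -> continuous f ->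
  (forall x, `|x| <= r -> 0 <= f x) ->
  (forall x, `|x - a| <= s -> `|x| <= r /\ c <= f x) ->
  c * (2 * s) ^+ 3 <= intbox r f.
Proof.
move=> r0 s0 c0 cf f0 fc.
have fin : (\int[leb3]_(q in box3 0 r) (f (point3 q))%:E)%E \is a fin_num.
  by apply: integrable_fin_num; [exact: measurable_box3|exact: integrable_box].
rewrite -lee_fin /intbox /Rintegral fineK// integral_mkcond.
apply: (@integral_ge_box R _ a) => // q.
  rewrite patchE; case: ifPn => // /set_mem; rewrite /box3/= subr0 => h.
  by rewrite lee_fin f0.
rewrite /box3/= => /fc [h1 h2]; rewrite patchE mem_set/= ?subr0//.
Qed.

(** If F(x) > 0, then F exceeds F(x)/2 on a small cube about x. For large r this cube lies where the
    cutoff is at least (3/4)^3, so the integrals stay above a constant independent of r, against the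
    bound C/r. *)
Lemma cutoff_intbox_vanish (F : V -> R) (C : R) : continuous F ->
  (forall x, 0 <= F x) ->
  (forall r, 1 <= r -> intbox r (fun x => cutoff r x * cutoff r x * F x) <= C / r) ->
  forall x, F x = 0.
Proof.
move=> cF F0 FC x; apply/eqP; rewrite eq_le F0 andbT leNgt; apply/negP => Fx.
have [d /= d0 hd] : exists2 d : R, 0 < d & forall y, `|y - x| < d -> F x / 2 < F y.
  have /cvgrPdist_lt/(_ (F x / 2)) := cF x.
  rewrite divr_gt0// => /(_ isT)/nbhs_ballP[d /= d0 hd]; exists d => // y yx.
  have := hd y; rewrite /= -ball_normE/= distrC => /(_ yx).
  by rewrite ltr_norml => /andP[]; lra.
pose s := Num.min (d / 2) 1.
have s0 : 0 < s by rewrite lt_min divr_gt0// ltr01.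
have s1 : s <= 1 by rewrite ge_min lexx orbT.
have sd : s < d by rewrite gt_min; apply/orP; left; lra.
pose k := (3 / 4) ^+ 3 * (3 / 4) ^+ 3 * (F x / 2) * (2 * s) ^+ 3.
have k0 : 0 < k by rewrite !mulr_gt0// ?exprn_gt0//; lra.
(* The first summand puts the cube about x, of radius s <= 1, into the cube of radius r/2; the
   second one forces C/r < k. *)
pose r := 2 * (`|x| + 1) + `|C| / k + 1.
have Ck : 0 <= `|C| / k by rewrite divr_ge0// ltW.
have x0 : 0 <= `|x| by [].
have r1 : 1 <= r by rewrite /r; lra.
have r0 : 0 < r by lra.
have : k <= C / r.
  apply: le_trans (FC r r1); apply: (@intbox_ge_box _ x) => //.
  - exact: ltW.
  - exact: ltW.
  - by rewrite !mulr_ge0//; lra.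
  - have [_ cc _] := C1_cutoff r => y.
    exact: continuousM (continuousM (cc y) (cc y)) (cF y).
  - by move=> y yr; rewrite mulr_ge0// -expr2 sqr_ge0.
  move=> y yx; have yn : `|y| <= `|x| + 1.
    by rewrite -(subrK x y) (le_trans (ler_normD _ _))//; lra.
  have yr : `|y| <= 2^-1 * r by rewrite /r; lra.
  split; first by lra.
  have := cutoff_half r y r0 yr => h.
  have h0 : 0 <= (3 / 4 : R) ^+ 3 by rewrite exprn_ge0.
  apply: ler_pM; [exact: mulr_ge0|lra|exact: ler_pM|].
  by apply: ltW; apply: hd; exact: le_lt_trans sd.
apply/negP; rewrite -ltNge ltr_pdivrMr//.
apply: le_lt_trans (ler_norm C) _.
have : k * (`|C| / k) < k * r by rewrite ltr_pM2l// /r; lra.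
by rewrite mulrCA divff ?gt_eqF// mulr1.
Qed.
End CutoffBounds.

(** * Energy estimate: an L^2 field with curl curl G = 0 is curl free *)

Section Liouville.
Context {R : realType}.
Notation V := 'rV[R]_3.

Definition sqn (g : 'I_3 -> V -> R) (x : V) : R :=
  g 0 x * g 0 x + g 1 x * g 1 x + g 2 x * g 2 x.

Lemma sqn_ge0 g x : 0 <= sqn g x.
Proof. by rewrite /sqn -!expr2 !addr_ge0// sqr_ge0. Qed.

Lemma sqn_eq0 g x : sqn g x = 0 -> forall i, g i x = 0.
Proof.
rewrite /sqn -!expr2 => s0.
have := sqr_ge0 (g 0 x); have := sqr_ge0 (g 1 x); have := sqr_ge0 (g 2 x).
by move=> h2 h1 h0; apply: ord3P; apply/eqP; rewrite -sqrf_eq0; apply/eqP; lra.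
Qed.

Lemma C1_sqn {g dg} : (forall j, C1 (g j) (dg j)) ->
  C1 (sqn g) (fun i x => 2 * (g 0 x * dg 0 i x + g 1 x * dg 1 i x + g 2 x * dg 2 i x)).
Proof.
move=> Cg; have Cs j := C1M (Cg j) (Cg j).
by apply: (C1_eq (C1D (C1D (Cs 0) (Cs 1)) (Cs 2))) => // i x; ring.
Qed.

(** Young's inequality for a = grad phi, b = G, c = J, p = phi, k = 1/r^2. Since a . (b x c) = c .
    (a x b), half the square of p c + 2 a x b absorbs the mixed term and leaves 2 |a x b|^2 = 2
    (|a|^2 |b|^2 - (a . b)^2), at most 24 k |b|^2. *)
Lemma curl_energy_le (p k a0 a1 a2 b0 b1 b2 c0 c1 c2 : R) :
  a0 ^+ 2 + a1 ^+ 2 + a2 ^+ 2 <= 12 * k ->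
  2^-1 * (p * p * (c0 * c0 + c1 * c1 + c2 * c2))
    - 24 * k * (b0 * b0 + b1 * b1 + b2 * b2) <=
  p * p * (c0 * c0 + c1 * c1 + c2 * c2) +
  2 * p * (a0 * (b1 * c2 - b2 * c1) + a1 * (b2 * c0 - b0 * c2)
           + a2 * (b0 * c1 - b1 * c0)).
Proof.
move=> ak; set B := b0 * b0 + b1 * b1 + b2 * b2.
have B0 : 0 <= B by rewrite /B -!expr2 !addr_ge0 ?sqr_ge0.
have H : (a0 ^+ 2 + a1 ^+ 2 + a2 ^+ 2) * B <= 12 * k * B by rewrite ler_wpM2r.
have S0 := sqr_ge0 (p * c0 + 2 * (a1 * b2 - a2 * b1)).
have S1 := sqr_ge0 (p * c1 + 2 * (a2 * b0 - a0 * b2)).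
have S2 := sqr_ge0 (p * c2 + 2 * (a0 * b1 - a1 * b0)).
have S3 := sqr_ge0 (a0 * b0 + a1 * b1 + a2 * b2).
rewrite -subr_ge0.
suff : 0 <= 2^-1 * ((p * c0 + 2 * (a1 * b2 - a2 * b1)) ^+ 2
  + (p * c1 + 2 * (a2 * b0 - a0 * b2)) ^+ 2
  + (p * c2 + 2 * (a0 * b1 - a1 * b0)) ^+ 2)
  + 2 * (a0 * b0 + a1 * b1 + a2 * b2) ^+ 2
  + 2 * (12 * k * B - (a0 ^+ 2 + a1 ^+ 2 + a2 ^+ 2) * B).
  by move/le_trans; apply; rewrite le_eqVlt; apply/orP; left; apply/eqP;
    rewrite /B; field.
by lra.
Qed.

(* Test field: [psi (g x J)], with divergence
   [psi |J|^2 + 2 phi (grad phi . (g x J))] for [psi = phi^2]. *)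
Lemma curl_curl_free_curl_free (g J : 'I_3 -> V -> R)
    (dg dJ : 'I_3 -> 'I_3 -> V -> R) (N : R) :
  (forall j, C1 (g j) (dg j)) -> (forall j, C1 (J j) (dJ j)) ->
  (forall i x, J i x = dg (i + 2) (i + 1) x - dg (i + 1) (i + 2) x) ->
  (forall i x, dJ (i + 2) (i + 1) x = dJ (i + 1) (i + 2) x) ->
  0 <= N -> (forall r, 0 < r -> intbox r (sqn g) <= N) ->
  forall i x, J i x = 0.
Proof.
move=> Cg CJ gJ cJ N0 gN i x; apply: sqn_eq0; move: x.
have [_ cS _] := C1_sqn Cg; have [_ cF _] := C1_sqn CJ.
(* Half of the integral of psi |J|^2 is at most 24 N / r^2, hence at most 24 N / r as r >= 1. *)
apply: (@cutoff_intbox_vanish _ _ (48 * N)) => // [x|r r1]; first exact: sqn_ge0.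
have r0 : 0 < r by lra.
have Cp := C1_cutoff r; have [_ cp _] := Cp.
have CW j := C1M (C1M Cp Cp)
  (C1B (C1M (Cg (j + 1)) (CJ (j + 2))) (C1M (Cg (j + 2)) (CJ (j + 1)))).
have /(intbox_div r0 CW) : forall (j : 'I_3) (x : V), `|x 0 j| = r ->
    cutoff r x * cutoff r x *
      (g (j + 1) x * J (j + 2) x - g (j + 2) x * J (j + 1) x) = 0.
  by move=> j x /cutoff_boundary ->//; rewrite !mul0r.
rewrite /= => div0.
have cpF : continuous (fun x => cutoff r x * cutoff r x * sqn J x).
  by move=> x; exact: continuousM (continuousM (cp x) (cp x)) (cF x).
have cst (c : R) : continuous (fun _ : V => c) by exact: cst_continuous.
have r0' := ltW r0.
suff : 2^-1 * intbox r (fun x => cutoff r x * cutoff r x * sqn J x)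
    - 24 * r^-1 ^+ 2 * intbox r (sqn g) <= 0.
  have rN : 24 * r^-1 ^+ 2 * intbox r (sqn g) <= 24 * N / r.
    rewrite -mulrA -[leRHS]mulrA ler_wpM2l// mulrC.
    apply: ler_pM; rewrite ?sqr_ge0 ?gN//.
      by apply: Rintegral_ge0 => q _; exact: sqn_ge0.
    by rewrite expr2 ler_piMr ?invr_ge0// invf_le1.
  by rewrite -mulrA -[_ / r]mulrA in rN *; lra.
rewrite -!intboxZ// -intboxB//; last 2 first.
- by move=> x; exact: continuousM (cst _ x) (cpF x).
- by move=> x; exact: continuousM (cst _ x) (cS x).
rewrite -div0; apply: le_intbox => //.
- move=> x; exact: continuousB (continuousM (cst _ x) (cpF x))
    (continuousM (cst _ x) (cS x)).
- exact: continuous_div CW.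
move=> x xr; rewrite !ord3E.
have A : dcutoff r 0 x ^+ 2 + dcutoff r 1 x ^+ 2 + dcutoff r 2 x ^+ 2 <= 12 * r^-1 ^+ 2.
  have := sqr_dcutoff_le r 0 x r0 xr; have := sqr_dcutoff_le r 1 x r0 xr.
  by have := sqr_dcutoff_le r 2 x r0 xr; lra.
apply: le_trans (curl_energy_le (cutoff r x) _ _ _ _ (g 0 x) (g 1 x) (g 2 x)
  (J 0 x) (J 1 x) (J 2 x) A) _.
have e0 := gJ 0 x; have e1 := gJ 1 x; have e2 := gJ 2 x.
have f0 := cJ 0 x; have f1 := cJ 1 x; have f2 := cJ 2 x.
rewrite !ord3E in e0 e1 e2 f0 f1 f2.
(* In div (g x J) = J . curl g - g . curl J, the equations [f0], [f1], [f2] remove the second term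
   and [e0], [e1], [e2] turn the first one into |J|^2. *)
rewrite f0 f1 f2.
have -> : dg 2 1 x = J 0 x + dg 1 2 x by rewrite e0 subrK.
have -> : dg 0 2 x = J 1 x + dg 2 0 x by rewrite e1 subrK.
have -> : dg 1 0 x = J 2 x + dg 0 1 x by rewrite e2 subrK.
by rewrite le_eqVlt; apply/orP; left; apply/eqP; ring.
Qed.

End Liouville.

(** * Pohozaev-type identity: an L^2 field free of divergence and curl vanishes *)

Section Pohozaev.
Context {R : realType}.
Notation V := 'rV[R]_3.

Lemma cauchy_schwarz3 (a0 a1 a2 b0 b1 b2 : R) :
  (a0 * b0 + a1 * b1 + a2 * b2) ^+ 2 <=
  (a0 ^+ 2 + a1 ^+ 2 + a2 ^+ 2) * (b0 * b0 + b1 * b1 + b2 * b2).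
Proof.
rewrite -subr_ge0.
have -> : (a0 ^+ 2 + a1 ^+ 2 + a2 ^+ 2) * (b0 * b0 + b1 * b1 + b2 * b2) -
  (a0 * b0 + a1 * b1 + a2 * b2) ^+ 2 =
  (a0 * b1 - a1 * b0) ^+ 2 + (a1 * b2 - a2 * b1) ^+ 2 + (a2 * b0 - a0 * b2) ^+ 2.
  by ring.
by rewrite !addr_ge0 ?sqr_ge0.
Qed.

(** Here a = r grad phi and u = x/rho. The first product is at most (u . g)^2 + (a . g)^2 <= 13
    |g|^2 by Cauchy-Schwarz, and - u . a <= (|u|^2 + |a|^2)/2 <= 13/2; the sum 39/2 is rounded up to
    20. *)
Lemma stress_flux_le (a0 a1 a2 u0 u1 u2 g0 g1 g2 : R) :
  a0 ^+ 2 + a1 ^+ 2 + a2 ^+ 2 <= 12 -> u0 ^+ 2 + u1 ^+ 2 + u2 ^+ 2 <= 1 ->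
  2 * ((u0 * g0 + u1 * g1 + u2 * g2) * (a0 * g0 + a1 * g1 + a2 * g2)) -
    (g0 * g0 + g1 * g1 + g2 * g2) * (u0 * a0 + u1 * a1 + u2 * a2) <=
  20 * (g0 * g0 + g1 * g1 + g2 * g2).
Proof.
move=> ha hu; set B := g0 * g0 + g1 * g1 + g2 * g2.
have B0 : 0 <= B by rewrite /B -!expr2 !addr_ge0 ?sqr_ge0.
have := cauchy_schwarz3 a0 a1 a2 g0 g1 g2; have := cauchy_schwarz3 u0 u1 u2 g0 g1 g2.
rewrite -/B; set al := u0 * g0 + _ + _; set be := a0 * g0 + _ + _ => al2 be2.
have aB : (a0 ^+ 2 + a1 ^+ 2 + a2 ^+ 2) * B <= 12 * B by rewrite ler_wpM2r.
have uB : (u0 ^+ 2 + u1 ^+ 2 + u2 ^+ 2) * B <= 1 * B by rewrite ler_wpM2r.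
have ab := sqr_ge0 (al - be); rewrite sqrrB in ab.
have ua : - (u0 * a0 + u1 * a1 + u2 * a2) <= 13 / 2.
  have := sqr_ge0 (u0 + a0); have := sqr_ge0 (u1 + a1); have := sqr_ge0 (u2 + a2).
  by rewrite !sqrrD; lra.
have uaB : - (u0 * a0 + u1 * a1 + u2 * a2) * B <= 13 / 2 * B by rewrite ler_wpM2r.
by move: uaB; move: (u0 * a0 + _ + _) => w; rewrite mulNr [w * B]mulrC; lra.
Qed.

Definition invrho (x : V) : R := (Num.sqrt (1 + \sum_i x 0 i ^+ 2))^-1.

Lemma sqr_invrho (x : V) :
  invrho x ^+ 2 * (1 + (x 0 0 ^+ 2 + x 0 1 ^+ 2 + x 0 2 ^+ 2)) = 1.
Proof.
have h : 0 < 1 + (x 0 0 ^+ 2 + x 0 1 ^+ 2 + x 0 2 ^+ 2).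
  by rewrite ltr_pwDl// !addr_ge0 ?sqr_ge0.
by rewrite /invrho sum3 exprVn sqr_sqrtr ?ltW// mulVf ?gt_eqF.
Qed.

Lemma invrho_gt0 x : 0 < invrho x.
Proof.
by rewrite invr_gt0 sqrtr_gt0 ltr_pwDl// sumr_ge0// => i _; rewrite sqr_ge0.
Qed.

Lemma C1_invrho : C1 invrho (fun i x => - (x 0 i * invrho x ^+ 3)).
Proof.
have Cx j : C1 (fun x : V => x 0 j * x 0 j) _ := C1M (C1_coord j) (C1_coord j).
have Cu := C1D (C1_cst 1) (C1D (C1D (Cx 0) (Cx 1)) (Cx 2)).
set u := fun x : V => _ in Cu.
have uE x : u x = 1 + \sum_i x 0 i ^+ 2 by rewrite sum3 /u !expr2.
have u0 x : 0 < u x by rewrite uE ltr_pwDl// sumr_ge0// => i _; rewrite sqr_ge0.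
pose h (t : R) := (Num.sqrt t)^-1.
pose h' (t : R) := - 2^-1 * (Num.sqrt t)^-1 ^+ 3.
have hP x : is_derive (u x) 1 h (h' (u x)).
  have s0 : Num.sqrt (u x) != 0 by rewrite gt_eqF// sqrtr_gt0.
  apply: (is_derive_eq (is_deriveV s0 (is_derive1_sqrt (u0 x)))).
  by rewrite /h' /GRing.scale/=; field.
have cv : continuous (h \o u).
  move=> x; have cs : {for x, continuous (Num.sqrt \o u)}.
    apply: continuous_comp; first by case: Cu => _ c _; exact: c.
    exact: sqrt_continuous.
  by apply: (continuousV _ cs); rewrite /= gt_eqF// sqrtr_gt0.
have ch' : continuous (h' \o u).
  have -> : h' \o u = (fun x => - 2^-1 * ((h \o u) x * ((h \o u) x * (h \o u) x))).
    by apply/funext => x; rewrite /h' /h /= -expr2 -exprS.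
  move=> x; have c3 := continuousM (cv x) (continuousM (cv x) (cv x)).
  have c0 : {for x, continuous (fun _ : V => - 2^-1 : R)} by exact: cst_continuous.
  exact: continuousM c0 c3.
apply: (C1_eq (C1_comp _ _ Cu hP ch')) => [x|i x]; first by rewrite /= /h uE.
rewrite /h' uE -/(invrho x).
by move: i; apply: ord3P => /=; field.
Qed.

(* Test field: [psi X_i T_ij] with [X = x invrho] and [T] the stress tensor. *)
Lemma div_curl_free_eq0 (g : 'I_3 -> V -> R) (dg : 'I_3 -> 'I_3 -> V -> R) (N : R) :
  (forall j, C1 (g j) (dg j)) ->
  (forall x, dg 0 0 x + dg 1 1 x + dg 2 2 x = 0) ->
  (forall i x, dg (i + 2) (i + 1) x = dg (i + 1) (i + 2) x) ->
  0 <= N -> (forall r, 0 < r -> intbox r (sqn g) <= N) ->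
  forall i x, g i x = 0.
Proof.
move=> Cg div0 curl0 N0 gN i x; apply: sqn_eq0; move: x.
have CS := C1_sqn Cg; have [_ cS _] := CS; have [_ cf _] := C1_invrho.
(* The coercive part of - T : DX; the other part, (x . G)^2/rho^3, is nonnegative and gets
   dropped. *)
pose F x := 2^-1 * invrho x ^+ 3 * sqn g x.
have f0 x : 0 <= invrho x by exact: ltW (invrho_gt0 x).
move=> x; suff F0 : F x = 0.
  have c0 : 2^-1 * invrho x ^+ 3 != 0.
    by rewrite gt_eqF// mulr_gt0 ?invr_gt0// exprn_gt0// invrho_gt0.
  by have /eqP := F0; rewrite mulf_eq0 (negPf c0) => /eqP.
have cF : continuous F.
  move=> y; have c3 := continuousM (cf y) (continuousM (cf y) (cf y)).
  have c0 : {for y, continuous (fun _ : V => 2^-1 : R)} by exact: cst_continuous.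
  exact: continuousM (continuousM c0 c3) (cS y).
move: x; apply: (@cutoff_intbox_vanish _ _ (20 * N)) => // [x|r r1].
  by rewrite /F !mulr_ge0 ?exprn_ge0// sqn_ge0.
have r0 : 0 < r by lra.
have Cp := C1_cutoff r; have [_ cp _] := Cp.
have CX i := C1M (C1_coord i) C1_invrho.
(* The stress tensor T; [2^-1 *+ (i == j)] is half the Kronecker delta. *)
have CT i j := C1B (C1M (Cg i) (Cg j)) (C1M (C1_cst (2^-1 *+ (i == j))) CS).
have CXT j := C1D (C1D (C1M (CX 0) (CT 0 j)) (C1M (CX 1) (CT 1 j)))
   (C1M (CX 2) (CT 2 j)).
have CW j := C1M (C1M Cp Cp) (CXT j).
have cdiv := continuous_div CW.
have := intbox_div r0 CW.
match goal with |- (?A -> _) -> _ => have W0 : A end.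
  by move=> j x /cutoff_boundary ->//; rewrite !mul0r.
move=> /(_ W0) {W0} int0.
have cpF : continuous (fun x => cutoff r x * cutoff r x * F x).
  by move=> x; exact: continuousM (continuousM (cp x) (cp x)) (cF x).
have cst (c : R) : continuous (fun _ : V => c) by exact: cst_continuous.
have r0' := ltW r0.
suff : intbox r (fun x => cutoff r x * cutoff r x * F x)
    - 20 * r^-1 * intbox r (sqn g) <= 0.
  have rN : 20 * r^-1 * intbox r (sqn g) <= 20 * N / r.
    rewrite -mulrA -[leRHS]mulrA ler_wpM2l// mulrC.
    by rewrite ler_wpM2r ?invr_ge0 ?gN.
  by move: rN; move: (20 * r^-1 * _) => t; lra.
rewrite -!intboxZ// -intboxB//; last first.
  by move=> x; exact: continuousM (cst _ x) (cS x).
(* The vanishing integral of the divergence enters with the factor -1 because its bulk part psi T :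
   DX is negative. *)
rewrite -(mulr0 (- 1)) -int0 -intboxZ//; apply: le_intbox => //.
- by move=> x; exact: continuousB (cpF x) (continuousM (cst _ x) (cS x)).
- by move=> x; exact: continuousM (cst _ x) (cdiv x).
move=> x xr; have d := div0 x.
have c0 := curl0 0 x; have c1 := curl0 1 x; have c2 := curl0 2 x.
rewrite !ord3E in c0 c1 c2; rewrite /= c0 c1 c2.
have -> : dg 2 2 x = - dg 0 0 x - dg 1 1 x by lra.
pose f := invrho x; pose p := cutoff r x; pose a i := dcutoff r i x.
pose xG := x 0 0 * g 0 x + x 0 1 * g 1 x + x 0 2 * g 2 x.
pose aG := a 0 * g 0 x + a 1 * g 1 x + a 2 * g 2 x.
pose xa := x 0 0 * a 0 + x 0 1 * a 1 + x 0 2 * a 2.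
(* [1/rho^3 = 1/rho - |x|^2/rho^3] turns the trace part into a good sign. *)
have fE : f - f ^+ 3 * (x 0 0 ^+ 2 + x 0 1 ^+ 2 + x 0 2 ^+ 2) - f ^+ 3 = 0.
  have h := sqr_invrho x; rewrite -/f in h.
  by apply: (@addIr _ (f * (f ^+ 2 * (1 + (x 0 0 ^+ 2 + x 0 1 ^+ 2 + x 0 2 ^+ 2)))));
    rewrite [in RHS]h; ring.
(* The divergence of the test field: the flux through grad psi = 2 phi grad phi, and psi T : DX. No
   derivative of g survives because T is divergence free. *)
pose I := p * f * (2 * (xG * aG) - sqn g x * xa)
  - p * p * (2^-1 * f ^+ 3 * sqn g x + f ^+ 3 * xG ^+ 2).
rewrite ?(mulr1n, mulr0n) [X in _ <= -1 * X](_ : _ = I); last first.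
  transitivity (I + (- 2^-1 * sqn g x * p * p) *
      (f - f ^+ 3 * (x 0 0 ^+ 2 + x 0 1 ^+ 2 + x 0 2 ^+ 2) - f ^+ 3)); last first.
    by rewrite fE mulr0 addr0.
  by rewrite /I /xG /aG /xa /a /p /f /sqn; field.
have /andP[p0 p1] := cutoff_itv r x r0 xr.
have flux : p * f * (2 * (xG * aG) - sqn g x * xa) <= 20 * r^-1 * sqn g x.
  (* Multiplying grad phi by r makes the bound 12 independent of r; the compensating r^-1 is the
     decay of the flux. *)
  have ha : (r * a 0) ^+ 2 + (r * a 1) ^+ 2 + (r * a 2) ^+ 2 <= 12.
    have h j : (r * a j) ^+ 2 <= 4.
      rewrite exprMn -ler_pdivlMl ?exprn_gt0// -exprVn mulrC.
      exact: sqr_dcutoff_le.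
    by move: (h 0) (h 1) (h 2); lra.
  have hu : (f * x 0 0) ^+ 2 + (f * x 0 1) ^+ 2 + (f * x 0 2) ^+ 2 <= 1.
    rewrite !exprMn -!mulrDr -(sqr_invrho x) ler_wpM2l ?sqr_ge0//.
    by rewrite lerDr.
  have := stress_flux_le _ _ _ _ _ _ (g 0 x) (g 1 x) (g 2 x) ha hu.
  rewrite -/(sqn g x) => h.
  have pr : 0 <= p * r^-1 by rewrite mulr_ge0// invr_ge0.
  have {}h := ler_wpM2l pr h.
  have -> : p * f * (2 * (xG * aG) - sqn g x * xa) = p * r^-1 *
    (2 * ((f * x 0 0 * g 0 x + f * x 0 1 * g 1 x + f * x 0 2 * g 2 x) *
          (r * a 0 * g 0 x + r * a 1 * g 1 x + r * a 2 * g 2 x)) -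
     sqn g x * (f * x 0 0 * (r * a 0) + f * x 0 1 * (r * a 1)
       + f * x 0 2 * (r * a 2))).
    by rewrite /xG /aG /xa; field; rewrite gt_eqF.
  apply: le_trans h _.
  have : p * (r^-1 * sqn g x) <= r^-1 * sqn g x.
    by rewrite ler_piMl// mulr_ge0 ?invr_ge0// sqn_ge0.
  by rewrite mulrA => hp; rewrite mulrCA -[leRHS]mulrA ler_wpM2l.
have pos : 0 <= p * p * (f ^+ 3 * xG ^+ 2).
  apply: mulr_ge0; first exact: mulr_ge0.
  by apply: mulr_ge0; [exact/exprn_ge0/f0|exact: sqr_ge0].
by rewrite /F -/p -/f /I; move: flux pos; rewrite mulrDr; lra.
Qed.
End Pohozaev.

(** * Vector fields: coordinates, L^2 bound and scaling of the curl *)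

Section VectorFields.
Context {R : realType}.
Notation V := 'rV[R]_3.
Notation e i := (delta_mx 0 i : 'rV[R]_3).

Definition C1v (F : V -> V) :=
  [/\ forall i x, derivable F x (e i), continuous F
    & forall i, continuous (partial i F)].

Lemma C1v_coord {F} : C1v F ->
  forall j, C1 (fun x => F x 0 j) (fun i x => partial i F x 0 j).
Proof.
move=> [dF cF cdF] j; split=> [i x|x|i x].
- split; first by have /derivable_mxP := dF i x; exact.
  by rewrite /partial derive_mx// mxE.
- exact: continuous_comp (cF x) (@coord_continuous R 1 3 0 j (F x)).
- exact: continuous_comp (cdF i x) (@coord_continuous R 1 3 0 j _).
Qed.

Lemma coord_C1v {F : V -> V} {dF : 'I_3 -> 'I_3 -> V -> R} :
  (forall j, C1 (fun x => F x 0 j) (dF j)) ->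
  (forall i x, derivable F x (e i)) /\
  (forall i j x, partial i F x 0 j = dF j i x).
Proof.
move=> CF; have dF' i x : derivable F x (e i).
  apply/derivable_mxP => k j; rewrite (ord1 k).
  by have [h _ _] := CF j; case: (h i x).
split=> // i j x; rewrite /partial derive_mx// mxE.
by have [h _ _] := CF j; case: (h i x).
Qed.

Lemma curlE (F : V -> V) (x : V) (i : 'I_3) :
  curl F x 0 i = partial (i + 1) F x 0 (i + 2) - partial (i + 2) F x 0 (i + 1).
Proof. by rewrite mxE. Qed.

Lemma C1_curl {F} : (forall i, C1v (partial i F)) ->
  forall j, C1 (fun x => curl F x 0 j)
    (fun i x => partial i (partial (j + 1) F) x 0 (j + 2)
                - partial i (partial (j + 2) F) x 0 (j + 1)).
Proof.
move=> CF j.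
apply: (C1_eq (C1B (C1v_coord (CF (j + 1)) (j + 2)) (C1v_coord (CF (j + 2)) (j + 1))))
  => // x; by rewrite mxE.
Qed.

Lemma sqr_eucl (u : V) : eucl u ^+ 2 = u 0 0 * u 0 0 + u 0 1 * u 0 1 + u 0 2 * u 0 2.
Proof.
by rewrite sqr_sqrtr ?sumr_ge0// => [|i _]; rewrite ?sqr_ge0// sum3 !expr2.
Qed.

Lemma eucl_ge0 (u : V) : 0 <= eucl u. Proof. exact: sqrtr_ge0. Qed.

Lemma eucl_gt0 (u : V) : u != 0 -> 0 < eucl u.
Proof.
move=> u0; rewrite lt_def eucl_ge0 andbT; apply: contra u0 => /eqP e0.
have := sqr_eucl u; rewrite e0 expr0n/= -!expr2 => h.
have := sqr_ge0 (u 0 0); have := sqr_ge0 (u 0 1); have := sqr_ge0 (u 0 2) => h2 h1 h0.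
apply/eqP/rowP; apply: ord3P; rewrite mxE; apply/eqP; rewrite -sqrf_eq0; apply/eqP; lra.
Qed.

Lemma euclZ (k : R) (u : V) : 0 <= k -> eucl (k *: u) = k * eucl u.
Proof.
move=> k0; rewrite /eucl; under eq_bigr do rewrite mxE exprMn.
by rewrite -mulr_sumr sqrtrM ?sqr_ge0// sqrtr_sqr ger0_norm.
Qed.

Lemma continuous_eucl : continuous (@eucl R).
Proof.
move=> u; apply: continuous_comp; last exact: sqrt_continuous.
have -> : (fun u : V => \sum_i u 0 i ^+ 2) = 
   (fun u => u 0 0 * u 0 0 + u 0 1 * u 0 1 + u 0 2 * u 0 2).
  by apply/funext => v; rewrite sum3 !expr2.
have c (j : 'I_3) : {for u, continuous (fun v : V => v 0 j)} by exact: coord_continuous.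
exact: continuousD (continuousD (continuousM (c 0) (c 0)) (continuousM (c 1) (c 1)))
  (continuousM (c 2) (c 2)).
Qed.

Lemma intbox_le_normL2 (G : V -> V) :
  continuous G -> (normLp 2%:E G < +oo)%E -> exists2 N, 0 <= N &
  forall r, 0 < r -> intbox r (sqn (fun j x => G x 0 j)) <= N.
Proof.
move=> cG; rewrite /normLp => N2.
have E q : (`| (eucl (G (point3 q)))%:E | `^ 2 =
    (sqn (fun j x => G x 0 j) (point3 q))%:E)%E.
  rewrite gee0_abs ?lee_fin ?eucl_ge0// poweR_EFin.
  by rewrite powR_mulrn ?eucl_ge0// sqr_eucl.
have : (\int[leb3]_q (sqn (fun j x => G x 0 j) (point3 q))%:E < +oo)%E.
  under eq_integral do rewrite -E.
  by rewrite -poweR_Lnorm// poweR_lty.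
set I := (X in (X < _)%E) => Ioo.
have I0 : (0 <= I)%E by apply: integral_ge0 => q _; rewrite lee_fin sqn_ge0.
have Ifin : I \is a fin_num by rewrite ge0_fin_numE.
exists (fine I); first exact: fine_ge0.
move=> r r0; rewrite /intbox /Rintegral fine_le//.
  apply: integrable_fin_num; first by apply: measurable_box3; exact: ltW.
  apply: (@integrable_box _ (sqn (fun j x => G x 0 j))); first exact: ltW.
  have c j : continuous (fun x => G x 0 j).
    by move=> x; exact: continuous_comp (cG x) (@coord_continuous R 1 3 0 j (G x)).
  by move=> x; exact: continuousD (continuousD (continuousM (c 0 x) (c 0 x))
   (continuousM (c 1 x) (c 1 x))) (continuousM (c 2 x) (c 2 x)).
rewrite integral_mkcond; apply: ge0_le_integral_nonmeasurable => q _.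
  by rewrite patchE; case: ifPn; rewrite ?lee_fin ?sqn_ge0.
by rewrite patchE; case: ifPn; rewrite ?lee_fin ?sqn_ge0.
Qed.

Lemma curl_curl_div_free_L2_eq0 (G : V -> V) :
  C1v G -> (forall i, C1v (partial i G)) ->
  (forall x, div3 G x = 0) -> (forall x, curl (curl G) x = 0) ->
  (normLp 2%:E G < +oo)%E -> forall x, G x = 0.
Proof.
move=> CG CdG divG ccG G2 x.
have [N N0 hN] : exists2 N, 0 <= N &
  forall r, 0 < r -> intbox r (sqn (fun j x => G x 0 j)) <= N.
  by apply: intbox_le_normL2 => //; case: CG.
have Cg := C1v_coord CG; have CJ := C1_curl CdG.
have [_ pJ] := coord_C1v CJ.
have J0 : forall i x, curl G x 0 i = 0.
  apply: (curl_curl_free_curl_free _ _ _ _ N Cg CJ) => // [i y|i y].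
    exact: curlE.
  have h : partial (i + 1) (curl G) y 0 (i + 2) = partial (i + 2) (curl G) y 0 (i + 1).
    by apply/eqP; rewrite -subr_eq0 -curlE ccG mxE.
  exact: etrans (esym (pJ (i + 1) (i + 2) y)) (etrans h (pJ (i + 2) (i + 1) y)).
apply/rowP => i; rewrite mxE; move: i x.
apply: (div_curl_free_eq0 _ _ N Cg) => // [y|i y].
  by have := divG y; rewrite /div3 sum3.
by have := J0 i y; rewrite curlE => /eqP; rewrite subr_eq0 => /eqP ->.
Qed.

(** Only a directional derivative of G is given, so the change of step k = l h is made in the
    difference quotient itself; l != 0 keeps the step away from zero. *)
Lemma is_derive_scale (G : V -> V) (m l : R) (x v : V) : l != 0 ->
  derivable G (l *: x) v ->
  is_derive x v (fun y => m *: G (l *: y)) ((m * l) *: 'D_v G (l *: x)).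
Proof.
move=> l0 dG.
have h : (fun h : R => h^-1 *: (((fun y => m *: G (l *: y)) \o shift x) (h *: v)
     - m *: G (l *: x))) @ 0^' --> ((m * l) *: 'D_v G (l *: x) : V).
  have -> : (fun h : R => h^-1 *: (((fun y => m *: G (l *: y)) \o shift x) (h *: v)
     - m *: G (l *: x))) = (fun k : R => (m * l) *: (k^-1 *:
       ((G \o shift (l *: x)) (k *: v) - G (l *: x)))) \o (fun h => l * h).
    apply/funext => h /=; rewrite -scalerBr !scalerA [l *: (h *: v + x)]scalerDr !scalerA.
    by congr (_ *: _); rewrite invfM mulrA mulfK// mulrC.
  have hl : (fun h => l * h) @ (0 : R)^' --> (0 : R)^'.
    move=> A /= [d /= d0 dA]; exists (d / `|l|) => /=.
      by rewrite divr_gt0// normr_gt0.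
    move=> h; rewrite /= !sub0r !normrN => hd h0; apply: dA => /=.
      by rewrite sub0r normrN normrM mulrC -ltr_pdivlMr// normr_gt0.
    by rewrite mulf_neq0.
  by apply: (cvg_comp _ _ hl); apply: cvgZl_tmp; exact: dG.
by split; [apply/cvg_ex; exists ((m * l) *: 'D_v G (l *: x))|exact/cvg_lim].
Qed.

Lemma partial_scale (G : V -> V) (m l : R) (i : 'I_3) (x : V) : l != 0 ->
  derivable G (l *: x) (e i) ->
  partial i (fun y => m *: G (l *: y)) x = (m * l) *: partial i G (l *: x).
Proof. by move=> l0 /(is_derive_scale G m l x _ l0)[]. Qed.

Lemma curl_scale (G : V -> V) (m l : R) : l != 0 ->
  (forall i x, derivable G x (e i)) ->
  curl (fun y => m *: G (l *: y)) = (fun y => (m * l) *: curl G (l *: y)).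
Proof.
move=> l0 dG; apply/funext => x; apply/rowP => i.
rewrite curlE !partial_scale// [in RHS]mxE curlE mulrBr.
by congr (_ - _); rewrite mxE.
Qed.

End VectorFields.

(** * Lower bounds on norms and on time integrals *)

Section Norms.
Context {R : realType}.
Notation V := 'rV[R]_3.

Lemma normLp_ge_box (F : V -> V) (p c r : R) (a : V) :
  0 < p -> 0 <= c -> 0 <= r -> (forall x, `|x - a| <= r -> c <= eucl (F x)) ->
  ((c `^ p * (2 * r) ^+ 3)%:E <= normLp p%:E F `^ p)%E.
Proof.
move=> p0 c0 r0 cF; rewrite /normLp poweR_Lnorm ?gt_eqF//.
apply: (@integral_ge_box _ _ a) => //; first exact: powR_ge0.
  by move=> q; exact: poweR_ge0.
move=> q /cF h; rewrite gee0_abs; last by rewrite lee_fin eucl_ge0.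
rewrite poweR_EFin lee_fin.
by apply: ge0_ler_powR; [exact: ltW|rewrite nnegrE|rewrite nnegrE eucl_ge0|].
Qed.

(** Were the essential supremum below c, the cube, of positive measure, would lie in the exceptional
    null set. *)
Lemma normLoo_ge_box (F : V -> V) (c r : R) (a : V) :
  0 < r -> (forall x, `|x - a| <= r -> c <= eucl (F x)) ->
  (c%:E <= normLp +oo F)%E.
Proof.
move=> r0 cF; rewrite /normLp unlock.
have b0 : (0 < leb3 (box3 a r))%E.
  by rewrite lebesgue_measure_box3 ?(ltW r0)// lte_fin exprn_gt0// mulr_gt0.
have mb := measurable_box3 a r (ltW r0).
(* [Lnorm] at +oo is the essential supremum only on a space of positive measure. *)
have -> : (0 < leb3 [set: (measurableTypeR R * measurableTypeR R *
                                measurableTypeR R)%type])%E.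
  by apply: lt_le_trans b0 _; apply: le_measure; rewrite ?inE.
rewrite leNgt; apply/negP => lt.
have [N [mN N0 NP]] := ess_sup_ge leb3 (abse \o (fun q => (eucl (F (point3 q)))%:E)).
move: b0; apply/negP; rewrite -leNgt -N0; apply: le_measure; rewrite ?inE//.
move=> q bq; apply: NP => /= h; have := le_lt_trans h lt.
by rewrite lte_fin ger0_norm ?eucl_ge0// ltNge cF.
Qed.

(** The interval ]s, T[ has positive measure, so f cannot exceed its essential supremum throughout
    it. This provides actual times, as close to T as desired, at which the bound holds. *)
Lemma ess_sup_time_late (T s : R) (f : R -> \bar R) : 0 <= s < T ->
  exists t, s < t < T /\ (f t <= ess_sup_time T f)%E.
Proof.
move=> /andP[s0 sT]; apply: contrapT => H.
have [N [mN N0 NP]] := ess_sup_ge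
  (mrestr lebesgue_measure (measurable_itv `]0%R, T[) : {measure set _ -> \bar R}) f.
have : (lebesgue_measure (`]s, T[%classic : set (measurableTypeR R)) <= 0)%E.
  rewrite -N0 /mrestr; apply: le_measure; rewrite ?inE.
  - exact: measurable_itv.
  - by apply: measurableI => //; exact: measurable_itv.
  move=> t; rewrite /= in_itv/= => st; split.
    by apply: NP => /= h; apply: H; exists t.
  by move: st => /andP[st tT]; rewrite /= in_itv/= tT (le_lt_trans s0 st).
by rewrite lebesgue_measure_itv/= lte_fin sT -EFinB lee_fin leNgt subr_gt0 sT.
Qed.

Lemma powR_blowup (K q M : R) : 0 < K -> 0 < q ->
  exists2 d, 0 < d & forall s, 0 < s < d -> M < K * s `^ (- q).
Proof.
move=> K0 q0; pose M' := `|M| + 1.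
have M'0 : 0 < M' by rewrite ltr_wpDl.
have KM : 0 < K / M' by rewrite divr_gt0.
exists ((K / M') `^ q^-1); first exact: powR_gt0.
move=> s /andP[s0 sd]; have : s `^ q < K / M'.
  have := @gt0_ltr_powR _ _ q0 s ((K / M') `^ q^-1).
  rewrite -powRrM mulVf ?gt_eqF// powRr1 ?(ltW KM)//; apply => //.
    by rewrite nnegrE ltW.
  by rewrite nnegrE powR_ge0.
rewrite powRN ltr_pdivlMr// mulrC => h.
apply: (le_lt_trans (ler_norm M)); apply: (@lt_trans _ _ M'); first by rewrite /M'; lra.
by rewrite ltr_pdivlMr// powR_gt0.
Qed.

Lemma continuous_on_slice (T t : R) (A : set R) (F : R -> V -> V) : A t ->
  continuous_on A F -> continuous (F t).
Proof.
move=> At /subspace_continuousP cF x.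
have := cF (t, x) At; apply: cvg_trans.
move=> U; rewrite /nbhs /= => -[[P Q] /= [Pt Qx] PQ].
apply: filterS Qx => y Qy /=.
by apply: (PQ (t, y)) => //=; split => //=; exact: nbhs_singleton.
Qed.

Lemma continuous_gt_half_near (f : V -> R) (a : V) : continuous f -> 0 < f a ->
  exists2 d, 0 < d & forall x, `|x - a| <= d -> f a / 2 <= f x.
Proof.
move=> cf fa.
have /cvgrPdist_lt/(_ (f a / 2)) := cf a.
rewrite divr_gt0// => /(_ isT)/nbhs_ballP[d /= d0 hd].
exists (d / 2) => [|x xa]; first by rewrite divr_gt0.
have := hd x; rewrite /= -ball_normE/= distrC.
move=> /(_ (le_lt_trans xa _)); rewrite ltr_norml => h.
have /andP[_ h2] := h ltac:(lra).
lra.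
Qed.

Lemma integral_inv_ge (T k t : R) : 0 < k -> 0 < t < T ->
  (\int[lebesgue_measure]_(tau in `[0%R, t]) (k / (T - tau))%:E =
   (k * (ln T - ln (T - t)))%:E)%E.
Proof.
move=> k0 /andP[t0 tT].
have T0 : 0 < T by exact: lt_trans tT.
have pos s : s <= t -> 0 < T - s by move=> st; rewrite subr_gt0 (le_lt_trans st).
have dln s : s <= t -> is_derive s 1 (fun s => - k * ln (T - s)) (k / (T - s)).
  move=> st; have d1 : is_derive (T - s) 1 (@ln R) (T - s)^-1.
    exact: is_derive1_ln (pos _ st).
  have d2 : is_derive s 1 (fun s : R => T - s) (-1).
    by apply: (is_derive_eq (is_deriveB (is_derive_cst T s 1) (is_derive_id s 1)));
      rewrite sub0r.
  have d3 := @is_derive1_comp R (@ln R) (fun s : R => T - s) s _ _ d1 d2.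
  apply: (is_derive_eq (is_deriveZ (- k) d3)).
  by rewrite mulrN1 scalerN scaleNr opprK.
have cln s : s <= t -> {for s, continuous (fun s => - k * ln (T - s))}.
  by move=> st; apply: differentiable_continuous; apply/derivable1_diffP; case: (dln s st).
rewrite (@continuous_FTC2 R (fun s => k / (T - s)) (fun s => - k * ln (T - s)))//.
- by rewrite subr0 -EFinB; congr EFin; ring.
- apply: continuous_in_subspaceT => s; rewrite inE/= in_itv/= => /andP[_ st].
  have cs : {for s, continuous (fun s : R => T - s)}.
    by apply: cvgB; [exact: cvg_cst|exact: cvg_id].
  have ck : {for s, continuous (fun _ : R => k)} by exact: cst_continuous.
  by apply: (continuousM ck (continuousV _ cs)); rewrite gt_eqF ?pos.
- split=> [s||].
  + by rewrite in_itv/= => /andP[_ /ltW st]; case: (dln s st).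
  + by apply: cvg_at_right_filter; apply: cln; exact: ltW.
  + by apply: cvg_at_left_filter; exact: cln.
- by move=> s; rewrite in_itv/= => /andP[_ /ltW st]; rewrite derive1E; case: (dln s st).
Qed.

Lemma integral_ge_inv_lim (T k : R) (f : R -> \bar R) : 0 < k -> 0 < T ->
  (forall t : R, 0 <= t < T -> ((k / (T - t))%:E <= f t)%E) ->
  let I := fun t : R => (\int[lebesgue_measure]_(tau in `[0%R, t]) f tau)%E in
  cvg (I t @[t --> T^'-]) -> (lim (I t @[t --> T^'-]) = +oo)%E.
Proof.
move=> k0 T0 kf I cI; apply/eqyP => M M0 /=.
apply: lime_ge => //.
(* The threshold solves k (ln T - ln d) = M. *)
pose d := T * expR (- (M / k)).
have d0 : 0 < d by rewrite mulr_gt0// expR_gt0.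
near=> t.
have tT : t < T by near: t; exact: nbhs_left_lt.
have t0 : 0 < t by near: t; exact: nbhs_left_gt.
have td : T - t < d by rewrite ltrBlDr -ltrBlDl; near: t; apply: nbhs_left_gt; lra.
apply: (@le_trans _ _ (\int[lebesgue_measure]_(tau in `[0%R, t]) (k / (T - tau))%:E)%E).
  rewrite integral_inv_ge ?t0// lee_fin mulrC -ler_pdivrMr//.
  have : ln (T - t) <= ln d by rewrite ler_ln ?posrE ?subr_gt0// ltW.
  by rewrite lnM ?posrE ?expR_gt0// expRK; lra.
apply: ge0_le_integral_nonmeasurable => s /=; rewrite in_itv/= => /andP[s0 st].
  by rewrite lee_fin divr_ge0 ?(ltW k0)// subr_ge0 (le_trans st)// ltW.
by apply: kf; rewrite s0 (le_lt_trans st).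
Unshelve. all: by end_near. Qed.

End Norms.

(** * Blow-up of the norms of a rescaled profile *)

Section SelfSimilar.
Context {R : realType}.
Notation V := 'rV[R]_3.

Lemma continuous_row (F : V -> V) :
  (forall j, continuous (fun x => F x 0 j)) -> continuous F.
Proof.
move=> cF x; apply/(@cvgrPdist_le _ _ _ (nbhs x)) => eps e0.
near=> y; rewrite normr_rV3_le ?ltW//; apply/forallP => j.
rewrite !mxE; move: j; near: y; apply: filter_forall => j.
exact: ((cvgrPdist_le _ _).1 (cF j x)).
Unshelve. all: by end_near. Qed.

(** The constants c and d come from one neighbourhood of a and serve all scales m, l at once; this
    uniformity yields the blow-up rates. *)
Lemma scaled_field_ge (F : V -> V) (a : V) : continuous F -> F a != 0 ->
  exists c d, [/\ 0 < c, 0 < d & forall m l (x : V), 0 < m -> 0 < l ->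
    `|x - l^-1 *: a| <= d / l -> m * c <= eucl (m *: F (l *: x))].
Proof.
move=> cF Fa; have ce : continuous (fun x => eucl (F x)).
  by move=> x; exact: continuous_comp (cF x) (continuous_eucl (F x)).
have [d d0 hd] := continuous_gt_half_near _ a ce (eucl_gt0 _ Fa).
exists (eucl (F a) / 2), d; split=> //; first by rewrite divr_gt0 ?eucl_gt0.
move=> m l x m0 l0 xa; rewrite (euclZ _ _ (ltW m0)) ler_pM2l//; apply: hd.
have -> : l *: x - a = l *: (x - l^-1 *: a).
  by rewrite scalerBr scalerA divff ?scale1r// gt_eqF.
by rewrite normrZ gtr0_norm// mulrC -ler_pdivlMr.
Qed.

Section Profile.
Variables (T t0 : R) (G : V -> V) (B : R -> V -> V).
Hypothesis t0T : 0 <= t0 < T.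
(** Normalised by [s t0 = 1], so that [G] is the slice of [B] at [t0]. *)
Let s t := (T - t) / (T - t0).
Hypothesis BG : forall t, 0 <= t < T ->
  B t = fun x => s t `^ (- (3 / 7)) *: G (s t `^ (- (2 / 7)) *: x).

Let s_gt0 t : t < T -> 0 < s t.
Proof. by move=> tT; case/andP: t0T => _ h; rewrite divr_gt0// subr_gt0. Qed.

Lemma normLp_blowup (p : \bar R) (a : V) : continuous G -> G a != 0 ->
  (2%:E < p)%E -> (ess_sup_time T (fun t => normLp p (B t)) < +oo)%E -> False.
Proof.
move=> cG Ga p2; set M := ess_sup_time _ _ => Moo.
have /andP[t00 t0T'] := t0T.
have M0 : (0 <= M)%E.
  have [t [_]] := ess_sup_time_late T t0 (fun t => normLp p (B t)) t0T.
  by apply: le_trans; exact: Lnorm_ge0.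
have [c [d [c0 d0 cd]]] := scaled_field_ge G a cG Ga.
(* Times arbitrarily close to T at which the norm does obey the essential bound M. *)
have late dl : 0 < dl -> exists t, [/\ 0 <= t < T, 0 < s t < dl
    & (normLp p (B t) <= M)%E].
  move=> dl0; pose t1 := Num.max t0 (T - dl * (T - t0)).
  have t1T : 0 <= t1 < T.
    rewrite le_max t00/= gt_max t0T'/= ltrBlDr ltrDl mulr_gt0// subr_gt0//.
  have [t [/andP[t1t tT] h]] := ess_sup_time_late T t1 (fun t => normLp p (B t)) t1T.
  have : t0 < t by apply: le_lt_trans t1t; rewrite le_max lexx.
  have td : T - dl * (T - t0) < t by apply: le_lt_trans t1t; rewrite le_max lexx orbT.
  exists t; split => //; first by rewrite tT andbT; lra.
  by rewrite s_gt0//= ltr_pdivrMr ?subr_gt0//; lra.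
have box t : 0 <= t < T -> forall x,
    `|x - (s t `^ (- (2 / 7)))^-1 *: a| <= d / s t `^ (- (2 / 7)) ->
    s t `^ (- (3 / 7)) * c <= eucl (B t x).
  move=> /[dup] tT /andP[_ /s_gt0 st] x; rewrite (BG t tT).
  by apply: cd; exact: powR_gt0.
case: p p2 M Moo M0 late => [p p2 M Moo M0 late|_ M Moo M0 late|//].
- rewrite lte_fin in p2; have p0 : 0 < p by exact: lt_trans p2.
  have K0 : 0 < c `^ p * (2 * d) ^+ 3 by rewrite mulr_gt0 ?powR_gt0// exprn_gt0// mulr_gt0.
  (* The p-th power of the amplitude contributes s^(-3p/7), and the cube of radius d s^(2/7) a
     volume of order s^(6/7); the exponent is negative exactly for p > 2. *)
  have q0 : 0 < 3 / 7 * p - 6 / 7 by lra.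
  have [dl dl0 hdl] := powR_blowup _ _ (fine M `^ p) K0 q0.
  have [t [tT st hM]] := late dl dl0.
  have /andP[st0 _] := st; have sn0 : s t != 0 by rewrite gt_eqF.
  have r0 : 0 < d / s t `^ (- (2 / 7)) by rewrite divr_gt0// powR_gt0.
  have m0 : 0 <= s t `^ (- (3 / 7)) * c by rewrite mulr_ge0 ?powR_ge0 ?ltW.
  have := normLp_ge_box (B t) p _ _ _ p0 m0 (ltW r0) (box t tT).
  apply/negP; rewrite -ltNge.
  apply: (@le_lt_trans _ _ (M `^ p)%E).
    apply: gt0_ler_poweR => //; first exact: ltW.
      by rewrite in_itv/= leey andbT Lnorm_ge0.
    by rewrite in_itv/= leey andbT.
  have /fineK <- : M \is a fin_num by rewrite ge0_fin_numE.
  rewrite poweR_EFin lte_fin (lt_le_trans (hdl _ st))// le_eqVlt; apply/orP; left.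
  apply/eqP; rewrite powRM ?powR_ge0 ?(ltW c0)// -powRrM.
  rewrite (mulrA 2 d) [in RHS]exprMn exprVn -(powR_mulrn 3 (powR_ge0 (s t) _)) -powRrM -powRN.
  rewrite [RHS](_ : _ = c `^ p * (2 * d) ^+ 3 *
    (s t `^ (- (3 / 7) * p) * s t `^ (- (- (2 / 7) * 3)))); last by ring.
  congr (_ * _); rewrite -powRD; last by rewrite sn0 implybT.
  by congr (_ `^ _); field.
- have q0 : 0 < 3 / 7 :> R by lra.
  have [dl dl0 hdl] := powR_blowup _ _ (fine M) c0 q0.
  have [t [tT st hM]] := late dl dl0.
  have /andP[st0 _] := st.
  have r0 : 0 < d / s t `^ (- (2 / 7)) by rewrite divr_gt0// powR_gt0.
  have := normLoo_ge_box (B t) _ _ _ r0 (box t tT).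
  apply/negP; rewrite -ltNge; apply: (le_lt_trans hM).
  have /fineK <- : M \is a fin_num by rewrite ge0_fin_numE.
  by rewrite lte_fin mulrC hdl.
Qed.

Lemma curl_curl_blowup (a : V) : C1v G -> (forall i, C1v (partial i G)) ->
  curl (curl G) a != 0 ->
  let I := fun t : R =>
    (\int[lebesgue_measure]_(tau in `[0%R, t]) normLp +oo (curl (curl (B tau))))%E in
  cvg (I t @[t --> T^'-]) -> (lim (I t @[t --> T^'-]) = +oo)%E.
Proof.
move=> CG CdG cca; have /andP[t00 t0T'] := t0T.
have CJ := C1_curl CdG; have [dJ pJ] := coord_C1v CJ.
have ccc : continuous (curl (curl G)).
  have cJ i j : continuous (fun x => partial i (curl G) x 0 j).
    rewrite (funext (pJ i j)); by have [_ _] := CJ j; exact.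
  apply: continuous_row => j; rewrite (funext (fun x => curlE (curl G) x j)).
  by move=> x; exact: continuousB (cJ _ _ x) (cJ _ _ x).
have [c [d [c0 d0 cd]]] := scaled_field_ge _ a ccc cca.
apply: (integral_ge_inv_lim T (c * (T - t0))).
- by rewrite mulr_gt0// subr_gt0.
- exact: le_lt_trans t0T'.
move=> t /[dup] tT /andP[_ /[dup] tT' /s_gt0 st]; have sn0 : s t != 0 by rewrite gt_eqF.
rewrite (BG t tT); set l := s t `^ (- (2 / 7)); set m := s t `^ (- (3 / 7)).
have l0 : 0 < l by exact: powR_gt0.
have m0 : 0 < m by exact: powR_gt0.
have dG : forall i x, derivable G x (delta_mx 0 i) by case: CG.
rewrite curl_scale ?gt_eqF// curl_scale ?gt_eqF//.
(* Each curl brings out one factor l, and 3/7 + 2/7 + 2/7 = 1: the critical, logarithmically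
   divergent rate. *)
have mll : m * l * l = (s t)^-1.
  rewrite /m /l -!powRD ?sn0 ?implybT// -(powR_inv1 (ltW st)).
  by congr (_ `^ _); field.
rewrite mll.
have -> : c * (T - t0) / (T - t) = (s t)^-1 * c.
  by rewrite /s invf_div; ring.
apply: (normLoo_ge_box _ _ (d / l) (l^-1 *: a)); first by rewrite divr_gt0.
by move=> x; apply: cd => //; rewrite invr_gt0.
Qed.

End Profile.
End SelfSimilar.

(** * Exclusion of pseudo-self-similar solutions *)

Theorem theorem1p5 (R : realType) (T a1 a2 : R) (hT : 0 < T) :
  let lambda := fun t : R => a1 * (T - t) `^ (- (2 / 7)) in
  let mu := fun t : R => a2 * (T - t) `^ (- (3 / 7)) in
  ~ exists (B : R -> 'rV[R]_3 -> 'rV[R]_3) (H : 'rV[R]_3 -> 'rV[R]_3),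
      let J := fun t => curl (B t) in
      [/\ exists (t : R) (x : 'rV[R]_3), 0 <= t < T /\ B t x <> 0,
          classical_solution T B,
          forall (t : R) (x : 'rV[R]_3), 0 <= t < T -> B t x = mu t *: H (lambda t *: x),
          (ess_sup_time T (fun t => normLp 2%:E (B t)) < +oo)%E
        & (exists p : \bar R, (2%:E < p)%E /\
             (ess_sup_time T (fun t => normLp p (B t)) < +oo)%E)
          \/
          (let I := fun t : R =>
             (\int[lebesgue_measure]_(tau in `[0%R, t]) normLp +oo (curl (J tau)))%E
           in cvg (I t @[t --> T^'-]) /\ (lim (I t @[t --> T^'-]) < +oo)%E)].
Proof.
move=> lambda mu [B [H [[t1 [x1 [t1T Bt1]]] [reg [_ divB]] BH B2 cond]]].
have T00 : 0 <= (0 : R) < T by rewrite lexx hT.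
have [t0 [t0T' B0]] := ess_sup_time_late T 0 (fun t => normLp 2%:E (B t)) T00.
have {B2}B0 := le_lt_trans B0 B2.
have t0T : 0 <= t0 < T by case/andP: t0T' => /ltW -> ->.
have T0 : 0 < T - t0 by case/andP: t0T => _; rewrite subr_gt0.
set G := B t0 in B0.
pose s t := (T - t) / (T - t0).
(* Both factors are powers of T - t = s(t) (T - t_0). The powers of T - t_0, with [a1] and [a2], are
   absorbed into G, and the remaining scales are positive. *)
have BG t : 0 <= t < T ->
    B t = fun x => s t `^ (- (3 / 7)) *: G (s t `^ (- (2 / 7)) *: x).
  move=> tT; have Tt : 0 < T - t by case/andP: tT => _; rewrite subr_gt0.
  have E q : (T - t) `^ q = s t `^ q * (T - t0) `^ q.
    by rewrite -powRM ?divr_ge0 ?ltW// divfK// gt_eqF.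
  apply/funext => x; rewrite /G BH// BH// /mu /lambda !E !scalerA.
  by congr (_ *: H (_ *: _)); ring.
(* All slices are rescalings of G, so a nonzero value at time [t1] gives one at [t0]. *)
have [a Ga] : exists a, G a != 0.
  exists (s t1 `^ (- (2 / 7)) *: x1); apply/eqP => G0; apply: Bt1.
  by rewrite BG// G0 scaler0.
have [d1 d2 [cB cdB cddB] _ _] := reg.
have mt0 : `[0, T[%classic t0 by rewrite /= in_itv.
have CG : C1v G.
  split=> [i x||i]; first exact: d1.
    exact: (continuous_on_slice T t0 _ B mt0 cB).
  exact: (continuous_on_slice T t0 _ (fun t => partial i (B t)) mt0 (cdB i)).
have CdG i : C1v (partial i G).
  split=> [j x||j]; first exact: d2.
    exact: (continuous_on_slice T t0 _ (fun t => partial i (B t)) mt0 (cdB i)).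
  exact: (continuous_on_slice T t0 _ (fun t => partial j (partial i (B t))) mt0 (cddB i j)).
case: cond => [[p [p2 Bp]]|[cI lI]].
  by apply: (normLp_blowup T t0 G B t0T BG p a) => //; case: CG.
(* The vanishing theorem would contradict [Ga], so it remains to show curl (curl G) = 0 at every
   point; a point where it fails makes the time integral diverge. *)
move: Ga; rewrite (curl_curl_div_free_L2_eq0 G) ?eqxx// => [x|x].
  exact: divB.
apply: contrapT => /eqP cca.
by move: lI; rewrite (curl_curl_blowup T t0 G B t0T BG x CG CdG cca cI).
Qed.
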